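(* Let $\mathcal{L}$ be a fragment of $\mathsf{HDFOLR}$ that is semantically closed under equality, retrieve, negation, disjunction, possibility over binary modalities, and quantifiers. Assume that $\mathcal{L}$ has the $\alpha$-Omitting Types Property, where $\alpha$ is an infinite cardinal. Let $T$ be a satisfiable theory (of $\mathcal L$-sentences) over a signature $\Delta$ of $\mathcal{L}$ of power at most $\alpha$. Then there is a Kripke structure $(W,M)$ over $\Delta$ globally satisfying $T$ such that $\mathrm{card}(|W|)\leq\alpha$ and $\mathrm{card}(M_{w,s})\leq\alpha$ for all rigid sorts $s\in S^r$ (and all worlds $w$).
   Context: **The logic HDFOLR.** A first-order signature is $\Sigma=(S,F,P)$ with sorts $S$, function symbols $F=\{F_{ar\to s}\}_{(ar,s)\in S^*\times S}$ and relation symbols $P=\{P_{ar}\}_{ar\in S^*}$; its structures interpret each sort as a non-empty set. An $\mathsf{HDFOLR}$ signature is $\Delta=(\Sigma^n,\Sigma^r\subseteq\Sigma)$ where $\Sigma^n=(\{any\},F^n,P^n)$ is single-sorted, with $F^n$ a set of constants (nominals) and $P^n$ a set of binary relation symbols (modalities), $\Sigma=(S,F,P)$ is a many-sorted first-order signature, and $\Sigma^r=(S^r,F^r,P^r)$ is a subsignature of rigid symbols; the other symbols and sorts of $\Sigma$ are flexible. Put $S^e=S^r\cup\{any\}$. The power of $\Delta$ is the maximum of $\omega$ and the number of its symbols. Signature morphisms are pairs of first-order signature morphisms $\Sigma^n\to\Sigma_1^n$, $\Sigma\to\Sigma_1$, the second mapping $\Sigma^r$ into $\Sigma_1^r$.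 For a set $C=\{C_s\}_{s\in S^e}$ of new constants (or variables), $\Delta[C]$ is $\Delta$ with $C_{any}$ added to $F^n$ and the $C_s$, $s\in S^r$, added to $F^r$. A Kripke structure over $\Delta$ is $(W,M)$ where $W$ is a $\Sigma^n$-structure with non-empty universe $|W|$ of worlds and $M$ assigns to each $w\in|W|$ a first-order $\Sigma$-structure $M_w$ such that all $M_w$ have the same reduct to $\Sigma^r$. Expansions and reducts are as usual. Actions: $a::=\lambda\mid a;a\mid a\cup a\mid a^*$ with $\lambda\in P^n$, interpreted by relational composition, union and reflexive-transitive closure; $a^n$ is $n$-fold composition and $\langle a^0\rangle\gamma$ means $\gamma$. For $k\in F^n$ each symbol (sort, function, relation) $x$ of $\Sigma$ yields a symbol $@_kx$, with $@_kx:=x$ if $x$ is rigid, and with $@_k\sigma:@_k ar\to @_k s$ for $\sigma:ar\to s$, similarly for relations. Rigid terms are terms over the signature $@\Sigma$ of all symbols $@_kx$. Hybrid terms are terms over $\overline\Sigma$, which consists of $\Sigma$ together with all $@_kx$, $x$ flexible. In a world $w$: $M_{w,\sigma(t)}=M_{w,\sigma}(M_{w,t})$, $M_{w,(@_k\sigma)(t)}=M_{W_k,\sigma}(M_{w,t})$, and $@_k\pi$ is interpreted as $M_{W_k,\pi}$. Sentences over $\Delta$: $\gamma::=k\mid t_1=t_2\mid\pi(t)\mid @_k\gamma\mid\neg\gamma\mid\vee\Gamma\mid{\downarrow}z\cdot\gamma'\mid\exists X\cdot\gamma''\mid\langle a\rangle\gamma$, with $k\in F^n$, $t_i,t$ hybrid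 terms, $\pi$ a relation symbol of $\overline\Sigma$, $\Gamma$ a finite set of sentences, $z$ a nominal variable and $\gamma'$ a $\Delta[z]$-sentence, $X$ a finite set of variables with sorts in $S^e$ and $\gamma''$ a $\Delta[X]$-sentence, $a$ an action. Operators are called retrieve ($@$), negation, disjunction, store (${\downarrow}$), existential quantification, possibility. Local satisfaction: $(W,M)\models^w k$ iff $W_k=w$; equations and relations are evaluated in $M_w$; $\models^w @_k\gamma$ iff $\models^{W_k}\gamma$; $\neg,\vee$ as usual; $(W,M)\models^w{\downarrow}z\cdot\gamma$ iff $(W^{z\leftarrow w},M)\models^w\gamma$ (the expansion interpreting $z$ as $w$); $(W,M)\models^w\exists X\cdot\gamma$ iff some expansion to $\Delta[X]$ satisfies $\gamma$ at $w$; $\models^w\langle a\rangle\gamma$ iff $\models^{w'}\gamma$ for some $w'$ with $(w,w')\in W_a$. Global satisfaction $(W,M)\models\gamma$ means $(W,M)\models^w\gamma$ for all $w$; $(W,M)\models\Gamma$ means this for all $\gamma\in\Gamma$; $T\models\Gamma$ means every Kripke structure globally satisfying $T$ globally satisfies $\Gamma$; a set of sentences is satisfiable if some Kripke structure globally satisfies it. A substitution $\theta:C_1\to C_2$ over $\Delta$ maps each new constant in $C_1$ of sort $any$ to a nominal of $\Delta[C_2]$ and each new constant of rigid sort $s$ to a rigid term of sort $s$ over $\Delta[C_2]$; it extends to a map $\gamma\mapsto\theta(\gamma)$ from $\Delta[C_1]$-sentences to $\Delta[C_2]$-sentences. **Fragments.** A fragment $\mathcal{L}$ consists of a subcategory $\mathrm{Sig}^{\mathcal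 L}$ of $\mathsf{HDFOLR}$ signatures and a subfunctor $\mathrm{Sen}$ of the $\mathsf{HDFOLR}$ sentence functor on it (same Kripke structures) such that: (1) for $\Delta\in\mathrm{Sig}^{\mathcal L}$ and sets $C$, $D$ of new nominals and new rigid constants, the inclusion $\Delta\hookrightarrow\Delta[C,D]$ is in $\mathrm{Sig}^{\mathcal L}$; (2) $\theta(\gamma)\in\mathrm{Sen}(\Delta[C_2,D_2])$ for every substitution $\theta:\langle C_1,D_1\rangle\to\langle C_2,D_2\rangle$ and $\gamma\in\mathrm{Sen}(\Delta[C_1,D_1])$; (3) it is closed under subsentences: $\langle a_1;a_2\rangle\gamma$ or $\langle a_1\cup a_2\rangle\gamma$ in $\mathrm{Sen}(\Delta)$ implies $\langle a_1\rangle\gamma,\langle a_2\rangle\gamma\in\mathrm{Sen}(\Delta)$; $\langle a^*\rangle\gamma\in\mathrm{Sen}(\Delta)$ implies $\langle a^n\rangle\gamma\in\mathrm{Sen}(\Delta)$ for all $n\in\omega$; each of $\langle a\rangle\gamma$, $\neg\gamma$, $@_k\gamma$ in $\mathrm{Sen}(\Delta)$ implies $\gamma\in\mathrm{Sen}(\Delta)$; $\vee\Gamma\in\mathrm{Sen}(\Delta)$ implies $\Gamma\subseteq\mathrm{Sen}(\Delta)$; ${\downarrow}z\cdot\gamma\in\mathrm{Sen}(\Delta)$ implies $\gamma\in\mathrm{Sen}(\Delta[z])$; $\exists X\cdot\gamma\in\mathrm{Sen}(\Delta)$ implies $\gamma\in\mathrm{Sen}(\Delta[X])$. $\mathcal{L}$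 is semantically closed under a sentence-building operator if the result of applying it to $\mathcal{L}$-sentences is always satisfied at the same worlds of the same Kripke structures as some $\mathcal{L}$-sentence. It is semantically closed under equality if for every nominal $k$ some $\mathcal{L}$-sentence holds at $w$ exactly when $w=W_k$, and for all $t_1,t_2\in T_{\overline\Sigma}$ some $\mathcal{L}$-sentence holds at $w$ exactly when $M_{w,t_1}=M_{w,t_2}$. **Omitting types.** Let $X=\{X_s\}_{s\in S^e}$ be variables for $\Delta$ with every $X_s$ finite and $\Gamma\subseteq\mathrm{Sen}(\Delta[X])$ (a type). A Kripke structure $(W,M)$ over $\Delta$ realizes $\Gamma$ if some expansion of it to $\Delta[X]$ globally satisfies $\Gamma$; otherwise it omits $\Gamma$. A theory $T\subseteq\mathrm{Sen}(\Delta)$ $\alpha$-realizes $\Gamma$ if there are a set $C=\{C_s\}_{s\in S^e}$ of new constants with $\mathrm{card}(C_s)<\alpha$ for all $s$, a substitution $\theta:X\to C$ over $\Delta$, and $p\subseteq\mathrm{Sen}(\Delta[C])$ with $\mathrm{card}(p)<\alpha$, such that $T\cup p$ is satisfiable and $T\cup p\models\theta(\Gamma)$; otherwise $T$ $\alpha$-omits $\Gamma$. $\mathcal{L}$ has the $\alpha$-Omitting Types Property if for every signature $\Delta$ of $\mathcal L$ of power at most $\alpha$, every satisfiable $T\subseteq\mathrm{Sen}(\Delta)$ and every family of types $\{\Gamma^i\subseteq\mathrm{Sen}(\Delta[X^i])\mid i<\alpha\}$ (each $X^i_s$ finite) such that $T$ $\alpha$-omits $\Gamma^i$ for all $i<\alpha$,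 there is a Kripke structure over $\Delta$ that globally satisfies $T$ and omits $\Gamma^i$ for all $i<\alpha$. *)

(* Defs.v *)
From mathcomp Require Import all_boot.
From mathcomp Require Import all_classical.
From Stdlib Require Import Relation_Operators.

Set Implicit Arguments.
Unset Strict Implicit.
Unset Printing Implicit Defensive.

Local Open Scope classical_set_scope.
Local Open Scope card_scope.

(** * Signatures *)

(* A word s_1 ... s_n of sorts is a map from 'I_n to sorts.  The inclusion of
   Sigma^r in Sigma is given by its rigid part and the remaining, flexible,
   part: the sorts of Sigma are the disjoint union of the rigid and the flexible
   ones, the rigid symbols only involve rigid sorts, and the flexible symbols
   may involve all sorts.  Sigma^n is given by its constants [nom] and its
   binary relation symbols [modality].                                        *)
Record hsig := HSig {
  nom : Type;
  modality : Type;
  rsort : Type;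
  fsort : Type;
  rfun : forall n, ('I_n -> rsort) -> rsort -> Type;
  ffun : forall n, ('I_n -> rsort + fsort) -> rsort + fsort -> Type;
  rrel : forall n, ('I_n -> rsort) -> Type;
  frel : forall n, ('I_n -> rsort + fsort) -> Type
}.

Definition fosort (D : hsig) : Type := (rsort D + fsort D)%type.

(* S^e = S^r + {any}; [None] is the sort any. *)
Definition esort (D : hsig) : Type := option (rsort D).

(* All the symbols of Sigma, rigid and flexible.  The arity and the sort of a
   rigid symbol are words over S^r, hence the equations.                      *)
Inductive funsym (D : hsig) n (ar : 'I_n -> fosort D) (s : fosort D) : Type :=
| FRig (ar' : 'I_n -> rsort D) (s' : rsort D) of
    rfun ar' s' & (forall i, inl (ar' i) = ar i) & inl s' = s
| FFlex of ffun ar s.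

Inductive relsym (D : hsig) n (ar : 'I_n -> fosort D) : Type :=
| RRig (ar' : 'I_n -> rsort D) of rrel ar' & (forall i, inl (ar' i) = ar i)
| RFlex of frel ar.

(* The disjoint union of all the symbols (including the sorts). *)
Definition symbol (D : hsig) : Type :=
  (nom D + modality D + rsort D + fsort D
   + {n : nat & {ar : 'I_n -> rsort D & {s : rsort D & rfun ar s}}}
   + {n : nat & {ar : 'I_n -> fosort D & {s : fosort D & ffun ar s}}}
   + {n : nat & {ar : 'I_n -> rsort D & rrel ar}}
   + {n : nat & {ar : 'I_n -> fosort D & frel ar}})%type.

(* Cardinals are represented by types.  The power of D is the maximum of omega
   and of the number of symbols.                                              *)
Definition power_le (D : hsig) (A : Type) : Prop :=
  ([set: nat] #<= [set: A]) /\ ([set: symbol D] #<= [set: A]).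

Definition card_lt T U (X : set T) (Y : set U) : Prop :=
  (X #<= Y) /\ ~ (Y #<= X).

(* D[C], where the family C = {C_s}, s in S^e, of new constants is given by its
   total space C and the map srt, so that C_s is the fibre of srt at s.       *)
Definition extend (D : hsig) (C : Type) (srt : C -> esort D) : hsig :=
  {| nom := nom D + {c : C | srt c = None};
     modality := modality D;
     rsort := rsort D;
     fsort := fsort D;
     rfun := fun n ar s =>
       (rfun ar s + {c : C | n = 0%N /\ srt c = Some s})%type;
     ffun := fun n ar s => ffun ar s;
     rrel := fun n ar => rrel ar;
     frel := fun n ar => frel ar |}.

(** * Symbol maps and signature morphisms *)

(* R n ar s is the collection of the possible images of the rigid function
   symbols with arity ar and sort s: the rigid function symbols of D2 in the
   case of signature morphisms, and also terms in the case of substitutions.  *)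
Record symmap (D1 D2 : hsig)
    (R : forall n, ('I_n -> rsort D2) -> rsort D2 -> Type) := SymMap {
  on_nom : nom D1 -> nom D2;
  on_mod : modality D1 -> modality D2;
  on_sort : fosort D1 -> fosort D2;
  on_rsort : rsort D1 -> rsort D2;
  on_sort_rig : forall s, inl (on_rsort s) = on_sort (inl s);
  on_rfun : forall n (ar : 'I_n -> rsort D1) s,
    rfun ar s -> R n (fun i => on_rsort (ar i)) (on_rsort s);
  on_ffun : forall n (ar : 'I_n -> fosort D1) s,
    ffun ar s -> funsym (fun i => on_sort (ar i)) (on_sort s);
  on_rrel : forall n (ar : 'I_n -> rsort D1),
    rrel ar -> rrel (fun i => on_rsort (ar i));
  on_frel : forall n (ar : 'I_n -> fosort D1),
    frel ar -> relsym (fun i => on_sort (ar i))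
}.

Definition sigmor (D1 D2 : hsig) : Type := symmap D1 (@rfun D2).

Definition mor_func D1 D2 (g : sigmor D1 D2) n (ar : 'I_n -> fosort D1) s
    (f : funsym ar s) : funsym (fun i => on_sort g (ar i)) (on_sort g s) :=
  match f with
  | FRig ar' s' f' e e' =>
      FRig (on_rfun g f')
        (fun i => etrans (on_sort_rig g (ar' i)) (f_equal (on_sort g) (e i)))
        (etrans (on_sort_rig g s') (f_equal (on_sort g) e'))
  | FFlex f' => on_ffun g f'
  end.

Definition mor_rel D1 D2 (g : sigmor D1 D2) n (ar : 'I_n -> fosort D1)
    (p : relsym ar) : relsym (fun i => on_sort g (ar i)) :=
  match p with
  | RRig ar' p' e =>
      RRig (on_rrel g p')
        (fun i => etrans (on_sort_rig g (ar' i)) (f_equal (on_sort g) (e i)))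
  | RFlex p' => on_frel g p'
  end.

Definition mor_id (D : hsig) : sigmor D D :=
  @SymMap D D (@rfun D) id id id id (fun=> erefl) (fun n ar s f => f)
    (fun n ar s f => FFlex f) (fun n ar p => p) (fun n ar p => RFlex p).

Definition mor_comp D1 D2 D3 (h : sigmor D2 D3) (g : sigmor D1 D2) :
    sigmor D1 D3 :=
  @SymMap D1 D3 (@rfun D3)
    (fun k => on_nom h (on_nom g k))
    (fun m => on_mod h (on_mod g m))
    (fun s => on_sort h (on_sort g s))
    (fun s => on_rsort h (on_rsort g s))
    (fun s => etrans (on_sort_rig h (on_rsort g s))
                     (f_equal (on_sort h) (on_sort_rig g s)))
    (fun n ar s f => on_rfun h (on_rfun g f))
    (fun n ar s f => mor_func h (on_ffun g f))
    (fun n ar p => on_rrel h (on_rrel g p))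
    (fun n ar p => mor_rel h (on_frel g p)).

Definition incl (D : hsig) C (srt : C -> esort D) : sigmor D (extend srt) :=
  @SymMap D (extend srt) (@rfun (extend srt)) inl id id id (fun=> erefl)
    (fun n ar s f => inl f)
    (fun n ar s f => @FFlex (extend srt) n ar s f)
    (fun n ar p => p)
    (fun n ar p => @RFlex (extend srt) n ar p).

(** * Hybrid terms *)

(* The symbols of overline-Sigma are the rigid symbols of Sigma and two kinds of
   copies of each flexible symbol x: the pair (None, x) stands for x itself, and
   (Some k, x) for @_k x.                                                     *)
Definition hsort (D : hsig) : Type := (rsort D + option (nom D) * fsort D)%type.

(* s if l = None, and @_k s if l = Some k; in particular @_k s = s for s rigid. *)
Definition at_sort (D : hsig) (l : option (nom D)) (s : fosort D) : hsort D :=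
  match s with inl r => inl r | inr f => inr (l, f) end.

Inductive hterm (D : hsig) : hsort D -> Type :=
| TRig n (ar : 'I_n -> rsort D) (s : rsort D) (f : rfun ar s)
    (ts : forall i, hterm (inl (ar i))) : hterm (inl s)
| TFlex (l : option (nom D)) n (ar : 'I_n -> fosort D) (s : fosort D)
    (f : ffun ar s) (ts : forall i, hterm (at_sort l (ar i))) :
    hterm (at_sort l s).

(* Rigid terms: the terms over @Sigma. *)
Fixpoint rigid_term D so (t : hterm (D := D) so) : Prop :=
  match t with
  | TRig _ _ _ _ ts => forall i, rigid_term (ts i)
  | TFlex l _ _ _ _ ts => l <> None /\ forall i, rigid_term (ts i)
  end.

(* x(ts) if l = None, and (@_k x)(ts) if l = Some k, for an arbitrary function
   symbol x of Sigma.                                                         *)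
Definition tapp D (l : option (nom D)) n (ar : 'I_n -> fosort D) (s : fosort D)
    (f : funsym ar s) (ts : forall i, hterm (at_sort l (ar i))) :
    hterm (at_sort l s) :=
  match f with
  | FRig ar' s' f' e e' =>
      ecast z (hterm (at_sort l z)) e'
        (TRig f' (fun i => ecast z (hterm (at_sort l z)) (esym (e i)) (ts i)))
  | FFlex f' => TFlex f' ts
  end.

(** * Sentences *)

Inductive action (M : Type) : Type :=
| AMod of M
| ASeq of action M & action M
| AUnion of action M & action M
| AStar of action M.

Fixpoint action_map M1 M2 (g : M1 -> M2) (a : action M1) : action M2 :=
  match a with
  | AMod m => AMod (g m)
  | ASeq a b => ASeq (action_map g a) (action_map g b)
  | AUnion a b => AUnion (action_map g a) (action_map g b)
  | AStar a => AStar (action_map g a)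
  end.

(* Finite sets of sentences and of variables are enumerated by some 'I_n. *)
Inductive sen (D : hsig) : Type :=
| SNom of nom D
| SEq (so : hsort D) of hterm so & hterm so
| SRRel n (ar : 'I_n -> rsort D) of rrel ar & (forall i, hterm (inl (ar i)))
| SFRel (l : option (nom D)) n (ar : 'I_n -> fosort D) of
    frel ar & (forall i, hterm (at_sort l (ar i)))
| SAt of nom D & sen D
| SNot of sen D
| SOr n of ('I_n -> sen D)
| SStore of sen (extend (fun _ : 'I_1 => None : esort D))
| SEx n (X : 'I_n -> esort D) of sen (extend X)
| SDia of action (modality D) & sen D.

Definition srel D (l : option (nom D)) n (ar : 'I_n -> fosort D) (p : relsym ar)
    (ts : forall i, hterm (at_sort l (ar i))) : sen D :=
  match p with
  | RRig ar' p' e =>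
      SRRel p' (fun i => ecast z (hterm (at_sort l z)) (esym (e i)) (ts i))
  | RFlex p' => SFRel p' ts
  end.

(* The sentence <a^n>gamma. *)
Definition dia_pow D (a : action (modality D)) (n : nat) (g : sen D) : sen D :=
  if n is m.+1 then SDia (iter m (ASeq a) a) g else g.

(** * Translation of sentences *)

(* A common generalization of signature morphisms and of substitutions, stable
   under the passage below a quantifier.                                      *)
Definition gmap (D1 D2 : hsig) : Type :=
  symmap D1 (fun n (ar : 'I_n -> rsort D2) s =>
    (rfun ar s + hterm (D := D2) (inl s))%type).

Definition gmap_of_mor D1 D2 (g : sigmor D1 D2) : gmap D1 D2 :=
  @SymMap D1 D2 (fun n ar s => (rfun ar s + hterm (inl s))%type)
    (on_nom g) (on_mod g) (on_sort g) (on_rsort g) (on_sort_rig g)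
    (fun n ar s f => inl (on_rfun g f))
    (fun n ar s f => on_ffun g f) (fun n ar p => on_rrel g p)
    (fun n ar p => on_frel g p).

Definition hsort_map D1 D2 (g : gmap D1 D2) (so : hsort D1) : hsort D2 :=
  match so with
  | inl r => inl (on_rsort g r)
  | inr (l, f) => at_sort (omap (on_nom g) l) (on_sort g (inr f))
  end.

Lemma hsort_map_at D1 D2 (g : gmap D1 D2) l s :
  at_sort (omap (on_nom g) l) (on_sort g s) = hsort_map g (at_sort l s).
Proof. by case: s => [r|f] //=; rewrite -on_sort_rig. Defined.

Fixpoint term_map D1 D2 (g : gmap D1 D2) so (t : hterm (D := D1) so) :
    hterm (hsort_map g so) :=
  match t with
  | TRig n ar s f ts =>
      match on_rfun g f with
      | inl f' => TRig f' (fun i => term_map g (ts i))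
      | inr t' => t'
      end
  | TFlex l n ar s f ts =>
      ecast z (hterm z) (hsort_map_at g l s)
        (tapp (on_ffun g f)
           (fun i => ecast z (hterm z) (esym (hsort_map_at g l (ar i)))
                       (term_map g (ts i))))
  end.

Definition incl_func D C (srt : C -> esort D) n (ar : 'I_n -> fosort D) s
    (f : funsym ar s) : funsym (D := extend srt) ar s :=
  match f with
  | FRig ar' s' f' e e' => @FRig (extend srt) n ar s ar' s' (inl f') e e'
  | FFlex f' => @FFlex (extend srt) n ar s f'
  end.

Definition incl_rel D C (srt : C -> esort D) n (ar : 'I_n -> fosort D)
    (p : relsym ar) : relsym (D := extend srt) ar :=
  match p with
  | RRig ar' p' e => @RRig (extend srt) n ar ar' p' e
  | RFlex p' => @RFlex (extend srt) n ar p'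
  end.

Definition lift_srt D1 D2 (g : gmap D1 D2) C (srt : C -> esort D1) :
    C -> esort D2 := fun c => omap (on_rsort g) (srt c).

Definition glift D1 D2 (g : gmap D1 D2) C (srt : C -> esort D1) :
    gmap (extend srt) (extend (lift_srt g srt)) :=
  let D1' := extend srt in let D2' := extend (lift_srt g srt) in
  @SymMap D1' D2'
    (fun n (ar : 'I_n -> rsort D2') s =>
       (rfun ar s + hterm (D := D2') (inl s))%type)
    (fun k => match k with
      | inl k' => inl (on_nom g k')
      | inr (exist c e) => inr (exist _ c (f_equal (omap (on_rsort g)) e))
      end)
    (on_mod g) (on_sort g) (on_rsort g) (on_sort_rig g)
    (fun n ar s f => match f with
      | inl f' =>
          match on_rfun g f' with
          | inl f'' => inl (inl f'')
          | inr t => inr (term_map (gmap_of_mor (incl (lift_srt g srt))) t)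
          end
      | inr (exist c (conj e0 e)) =>
          inl (inr (exist _ c (conj e0 (f_equal (omap (on_rsort g)) e))))
      end)
    (fun n ar s f => incl_func (lift_srt g srt) (on_ffun g f))
    (fun n ar p => on_rrel g p)
    (fun n ar p => incl_rel (lift_srt g srt) (on_frel g p)).

Fixpoint sen_map D1 D2 (g : gmap D1 D2) (phi : sen D1) : sen D2 :=
  match phi with
  | SNom k => SNom (on_nom g k)
  | SEq _ t1 t2 => SEq (term_map g t1) (term_map g t2)
  | SRRel _ _ p ts => SRRel (on_rrel g p) (fun i => term_map g (ts i))
  | SFRel l _ ar p ts =>
      srel (on_frel g p)
        (fun i => ecast z (hterm z) (esym (hsort_map_at g l (ar i)))
                    (term_map g (ts i)))
  | SAt k psi => SAt (on_nom g k) (sen_map g psi)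
  | SNot psi => SNot (sen_map g psi)
  | SOr _ Gam => SOr (fun i => sen_map g (Gam i))
  | SStore psi => SStore (sen_map (glift g (fun _ : 'I_1 => None)) psi)
  | SEx _ X psi => SEx (sen_map (glift g X) psi)
  | SDia a psi => SDia (action_map (on_mod g) a) (sen_map g psi)
  end.

Definition sen_tr D1 D2 (g : sigmor D1 D2) : sen D1 -> sen D2 :=
  sen_map (gmap_of_mor g).

Definition subst_val (D : hsig) (s : esort D) (D' : hsig)
    (h : rsort D -> rsort D') : Type :=
  match s with
  | None => nom D'
  | Some r => {t : hterm (D := D') (inl (h r)) | rigid_term t}
  end.

(* Substitutions C1 -> C2 over D. *)
Definition subst (D : hsig) C1 (srt1 : C1 -> esort D) C2 (srt2 : C2 -> esort D)
    : Type :=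
  forall c : C1, @subst_val D (srt1 c) (extend srt2) id.

Definition gmap_of_subst D C1 (srt1 : C1 -> esort D) C2 (srt2 : C2 -> esort D)
    (theta : subst srt1 srt2) : gmap (extend srt1) (extend srt2) :=
  let D1 := extend srt1 in let D2 := extend srt2 in
  let val := fun s : esort D => @subst_val D s D2 id in
  @SymMap D1 D2
    (fun n (ar : 'I_n -> rsort D2) s =>
       (rfun ar s + hterm (D := D2) (inl s))%type)
    (fun k => match k with
      | inl k' => inl k'
      | inr (exist c e) => ecast s (val s) e (theta c)
      end)
    id id id (fun=> erefl)
    (fun n ar s f => match f with
      | inl f' => inl (inl f')
      | inr (exist c (conj _ e)) =>
          inr (sval (ecast s (val s) e (theta c)))
      end)
    (fun n ar s f => @FFlex D2 n ar s f)
    (fun n ar p => p)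
    (fun n ar p => @RFlex D2 n ar p).

Definition sen_subst D C1 (srt1 : C1 -> esort D) C2 (srt2 : C2 -> esort D)
    (theta : subst srt1 srt2) : sen (extend srt1) -> sen (extend srt2) :=
  sen_map (gmap_of_subst theta).

(** * Kripke structures *)

Definition carrier (R F : Type) (rc : R -> Type) (fc : F -> Type) (s : R + F) :
    Type := match s with inl r => rc r | inr f => fc f end.

(* The first-order structures M_w share their reduct to the rigid symbols, given
   by the fields which do not depend on a world.                              *)
Record kripke (D : hsig) := Kripke {
  world : Type;
  world_ne : inhabited world;
  inom : nom D -> world;
  imod : modality D -> world -> world -> Prop;
  rcar : rsort D -> Type;
  rcar_ne : forall s, inhabited (rcar s);
  fcar : world -> fsort D -> Type;
  fcar_ne : forall w s, inhabited (fcar w s);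
  irfun : forall n (ar : 'I_n -> rsort D) s,
    rfun ar s -> (forall i, rcar (ar i)) -> rcar s;
  iffun : forall w n (ar : 'I_n -> fosort D) s,
    ffun ar s -> (forall i, carrier rcar (fcar w) (ar i)) ->
    carrier rcar (fcar w) s;
  irrel : forall n (ar : 'I_n -> rsort D),
    rrel ar -> (forall i, rcar (ar i)) -> Prop;
  ifrel : forall w n (ar : 'I_n -> fosort D),
    frel ar -> (forall i, carrier rcar (fcar w) (ar i)) -> Prop
}.

(* M_{w,s} *)
Definition mcar D (K : kripke D) (w : world K) (s : fosort D) : Type :=
  carrier (@rcar D K) (fcar w) s.

Definition ecar D (K : kripke D) (s : esort D) : Type :=
  match s with None => world K | Some r => rcar K r end.

(* The expansions of K to D[C] are the interpretations of C in K. *)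
Definition valuation D (K : kripke D) C (srt : C -> esort D) : Type :=
  forall c : C, ecar K (srt c).

Definition expand D (K : kripke D) C (srt : C -> esort D)
    (v : valuation K srt) : kripke (extend srt) :=
  @Kripke (extend srt) (world K) (world_ne K)
    (fun k => match k with
      | inl k' => inom K k'
      | inr (exist c e) => ecast s (ecar K s) e (v c)
      end)
    (@imod D K) (@rcar D K) (@rcar_ne D K) (@fcar D K) (@fcar_ne D K)
    (fun n ar s f => match f with
      | inl f' => irfun f'
      | inr (exist c (conj _ e)) => fun=> ecast s (ecar K s) e (v c)
      end)
    (@iffun D K) (@irrel D K) (@ifrel D K).

Definition at_world D (K : kripke D) (w : world K) (l : option (nom D)) :
    world K :=
  if l is Some k then inom K k else w.

Definition hcar D (K : kripke D) (w : world K) (so : hsort D) : Type :=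
  match so with
  | inl r => rcar K r
  | inr (l, f) => fcar (at_world w l) f
  end.

(* M_{w, @_k s} = M_{W_k, s}; both sides are convertible once s is known to be
   rigid or flexible.                                                         *)
Definition to_hcar D (K : kripke D) (w : world K) l (s : fosort D) :
    mcar (at_world w l) s -> hcar w (at_sort l s) :=
  match s with inl r => id | inr f => id end.

Definition of_hcar D (K : kripke D) (w : world K) l (s : fosort D) :
    hcar w (at_sort l s) -> mcar (at_world w l) s :=
  match s with inl r => id | inr f => id end.

Fixpoint eval D (K : kripke D) (w : world K) so (t : hterm so) : hcar w so :=
  match t with
  | TRig _ _ _ f ts => irfun f (fun i => eval w (ts i))
  | TFlex l _ _ _ f ts =>
      to_hcar (iffun (w := at_world w l) f (fun i => of_hcar (eval w (ts i))))
  end.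

Fixpoint iact D (K : kripke D) (a : action (modality D)) :
    world K -> world K -> Prop :=
  match a with
  | AMod m => imod m
  | ASeq a b => fun w w' => exists2 u, iact a w u & iact b u w'
  | AUnion a b => fun w w' => iact a w w' \/ iact b w w'
  | AStar a => clos_refl_trans _ (iact a)
  end.

Fixpoint sat D (K : kripke D) (w : world K) (phi : sen D) : Prop :=
  match phi with
  | SNom k => inom K k = w
  | SEq _ t1 t2 => eval w t1 = eval w t2
  | SRRel _ _ p ts => irrel p (fun i => eval w (ts i))
  | SFRel l _ _ p ts =>
      ifrel (w := at_world w l) p (fun i => of_hcar (eval w (ts i)))
  | SAt k psi => sat (inom K k) psi
  | SNot psi => ~ sat w psi
  | SOr _ Gam => exists i, sat w (Gam i)
  | SStore psi =>
      sat (K := expand (fun=> w : ecar K None)) w psi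
  | SEx _ X psi =>
      exists v : valuation K X, sat (K := expand v) w psi
  | SDia a psi => exists2 w', iact a w w' & sat w' psi
  end.

Definition gsat D (K : kripke D) (phi : sen D) : Prop :=
  forall w : world K, sat w phi.

Definition models D (K : kripke D) (T : set (sen D)) : Prop :=
  forall phi, T phi -> gsat K phi.

Definition satisfiable D (T : set (sen D)) : Prop :=
  exists K : kripke D, models K T.

Definition entails D (T G : set (sen D)) : Prop :=
  forall K : kripke D, models K T -> models K G.

(** * Fragments *)

Record fragment := Fragment {
  fsig : hsig -> Prop;
  fmor : forall D1 D2, sigmor D1 D2 -> Prop;
  fsen : forall D, set (sen D);
  (* Sig^L is a subcategory *)
  fmor_sig : forall D1 D2 (g : sigmor D1 D2), fmor g -> fsig D1 /\ fsig D2;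
  fmor_id : forall D, fsig D -> fmor (mor_id D);
  fmor_comp : forall D1 D2 D3 (h : sigmor D2 D3) (g : sigmor D1 D2),
    fmor h -> fmor g -> fmor (mor_comp h g);
  (* Sen^L is a subfunctor *)
  fsen_tr : forall D1 D2 (g : sigmor D1 D2) phi,
    fmor g -> fsen phi -> fsen (sen_tr g phi);
  fmor_incl : forall D C (srt : C -> esort D), fsig D -> fmor (incl srt);
  fsen_subst : forall D C1 (srt1 : C1 -> esort D) C2 (srt2 : C2 -> esort D)
    (theta : subst srt1 srt2) phi,
    fsig D -> fsen phi -> fsen (sen_subst theta phi);
  fsen_seq : forall D a b (phi : sen D), fsig D ->
    fsen (SDia (ASeq a b) phi) -> fsen (SDia a phi) /\ fsen (SDia b phi);
  fsen_union : forall D a b (phi : sen D), fsig D ->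
    fsen (SDia (AUnion a b) phi) -> fsen (SDia a phi) /\ fsen (SDia b phi);
  fsen_star : forall D a (phi : sen D), fsig D ->
    fsen (SDia (AStar a) phi) -> forall n, fsen (dia_pow a n phi);
  fsen_dia : forall D a (phi : sen D), fsig D -> fsen (SDia a phi) -> fsen phi;
  fsen_not : forall D (phi : sen D), fsig D -> fsen (SNot phi) -> fsen phi;
  fsen_at : forall D k (phi : sen D), fsig D -> fsen (SAt k phi) -> fsen phi;
  fsen_or : forall D n (Gam : 'I_n -> sen D), fsig D ->
    fsen (SOr Gam) -> forall i, fsen (Gam i);
  fsen_store : forall D (phi : sen (extend (fun _ : 'I_1 => None : esort D))),
    fsig D -> fsen (SStore phi) -> fsen phi;
  fsen_ex : forall D n (X : 'I_n -> esort D) (phi : sen (extend X)),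
    fsig D -> fsen (SEx phi) -> fsen phi
}.

(* The property P of pointed Kripke structures is expressed by a sentence of L. *)
Definition expressible (L : fragment) (D : hsig)
    (P : forall K : kripke D, world K -> Prop) : Prop :=
  exists2 phi : sen D, fsen L phi &
    forall (K : kripke D) (w : world K), sat w phi <-> P K w.

Definition closed_equality (L : fragment) : Prop :=
  forall D, fsig L D ->
    (forall k : nom D, expressible L (fun K w => w = inom K k)) /\
    (forall (so : hsort D) (t1 t2 : hterm so),
       expressible L (fun K w => eval w t1 = eval w t2)).

Definition closed_retrieve (L : fragment) : Prop :=
  forall D, fsig L D -> forall (k : nom D) (phi : sen D), fsen L phi ->
    expressible L (fun K w => sat w (SAt k phi)).

Definition closed_negation (L : fragment) : Prop :=
  forall D, fsig L D -> forall phi : sen D, fsen L phi ->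
    expressible L (fun K w => sat w (SNot phi)).

Definition closed_disjunction (L : fragment) : Prop :=
  forall D, fsig L D -> forall n (Gam : 'I_n -> sen D),
    (forall i, fsen L (Gam i)) ->
    expressible L (fun K w => sat w (SOr Gam)).

Definition closed_possibility (L : fragment) : Prop :=
  forall D, fsig L D -> forall (m : modality D) (phi : sen D), fsen L phi ->
    expressible L (fun K w => sat w (SDia (AMod m) phi)).

Definition closed_quantifiers (L : fragment) : Prop :=
  forall D, fsig L D -> forall n (X : 'I_n -> esort D) (phi : sen (extend X)),
    fsen L phi -> expressible L (fun K w => sat w (SEx phi)).

(** * Omitting types *)

Definition realizes D (K : kripke D) X (srt : X -> esort D)
    (G : set (sen (extend srt))) : Prop :=
  exists v : valuation K srt, models (expand v) G.

Definition omits D (K : kripke D) X (srt : X -> esort D)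
    (G : set (sen (extend srt))) : Prop := ~ realizes K G.

Definition card_realizes (L : fragment) (A : Type) D (T : set (sen D))
    X (srt : X -> esort D) (G : set (sen (extend srt))) : Prop :=
  exists (C : Type) (srtC : C -> esort D) (theta : subst srt srtC)
      (p : set (sen (extend srtC))),
    let Tp := sen_tr (incl srtC) @` T `|` p in
    [/\ forall s, card_lt [set c | srtC c = s] [set: A],
        p `<=` fsen L (D := extend srtC) /\ card_lt p [set: A],
        satisfiable Tp &
        entails Tp (sen_subst theta @` G)].

Definition card_omits (L : fragment) (A : Type) D (T : set (sen D))
    X (srt : X -> esort D) (G : set (sen (extend srt))) : Prop :=
  ~ card_realizes L A T G.

Definition OTP (L : fragment) (A : Type) : Prop :=
  forall D, fsig L D -> power_le D A ->
  forall T : set (sen D), T `<=` fsen L (D := D) -> satisfiable T ->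
  forall (X : A -> Type) (srt : forall i, X i -> esort D)
    (G : forall i, set (sen (extend (srt i)))),
    (forall i s, finite_set [set x | srt i x = s]) ->
    (forall i, G i `<=` fsen L (D := extend (srt i))) ->
    (forall i, card_omits L A T (G i)) ->
  exists2 K : kripke D, models K T & forall i, omits K (G i).

(* Main.v *)
(* A downward Loewenheim-Skolem argument.  Add alpha new constants of every
   sort of S^e to the signature, and consider, for every such sort s, the type in
   one variable x of sort s which says that x differs from all the new constants
   of sort s.  A structure omitting all these types has at most alpha worlds and
   at most alpha elements of every rigid sort.  The theory T alpha-omits them: a
   set p of fewer than alpha sentences and the image t of x under a substitution
   leave out one of the new constants, c say; since T does not mention c either,
   c may be reinterpreted as t in any model of T and p, so that T and p do not
   entail that t differs from c.  *)
From mathcomp Require Import all_boot.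
From mathcomp Require Import all_classical.
Require Import Defs.

Set Implicit Arguments.
Unset Strict Implicit.
Unset Printing Implicit Defensive.

Local Open Scope classical_set_scope.
Local Open Scope card_scope.

(** * Cardinals *)

Lemma sval_inj T (A : set T) : injective (@sval T A).
Proof. by move=> x y /eq_sig_hprop; apply=> ? ? ?; exact: Prop_irrelevance. Qed.

Lemma card_le_sigP T U (A : set T) (B : set U) :
  A #<= B <-> exists2 f : {x | A x} -> U, injective f & forall x, B (f x).
Proof.
split=> [/card_leP[f]|[f fI fB]].
  have fI : injective f by move=> x y; apply: inj; rewrite inE.
  exists (fun x => val (f (SigSub (mem_set (svalP x))))).
    by move=> x y /val_inj/fI[/sval_inj].
  by move=> x; apply: set_mem; exact: valP.
have AE : A = sval @` [set: {x | A x}].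
  by apply/seteqP; split=> [x Ax|_ [x _ <-]]; [exists (exist _ x Ax)|exact: svalP].
have /card_eqPle[le1 _] : A #= [set: {x | A x}].
  have : @sval T A @` setT #= [set: {x | A x}].
    by apply: inj_card_eq => x y _ _; exact: sval_inj.
  by rewrite -AE.
have /card_eqPle[_ le2] : range f #= [set: {x | A x}].
  by apply: inj_card_eq => x y _ _; exact: fI.
apply: card_le_trans le1 (card_le_trans le2 _).
by apply: subset_card_le => _ [x _ <-].
Qed.

Lemma card_leTTP T U :
  [set: T] #<= [set: U] <-> exists f : T -> U, injective f.
Proof.
split=> [/card_le_sigP[f fI _]|[f fI]].
  by exists (fun x => f (exist _ x Logic.I)) => x y /fI[].
by apply/card_le_sigP; exists (f \o sval) => //; exact: inj_comp (@sval_inj _ _).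
Qed.

(** Comparability of cardinals. Zorn's lemma gives a maximal graph [R] of a partial injection; were
    it neither total nor onto, an unmatched pair could be added to it. *)
Lemma injection_total T U :
  (exists f : T -> U, injective f) \/ (exists g : U -> T, injective g).
Proof.
pose P (R : set (T * U)) := forall x x' y y',
  R (x, y) -> R (x', y') -> x = x' <-> y = y'.
have [F FP totF|R [PR maxR]] := @Zorn_bigcup _ P.
  move=> x x' y y' [R1 F1 R1xy] [R2 F2 R2xy].
  by case: (totF _ _ F1 F2) => sub; [apply: (FP _ F2) => //; exact: sub
                                    |apply: (FP _ F1) => //; exact: sub].
have [[f Rf]|] := pselect (exists f : T -> U, forall x, R (x, f x)).
  by left; exists f => x x' /(PR _ _ _ _ (Rf x) (Rf x')).
have [[g Rg] _|] := pselect (exists g : U -> T, forall y, R (g y, y)).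
  by right; exists g => y y' /(PR _ _ _ _ (Rg y) (Rg y')).
have noch (V W : Type) (Q : V -> W -> Prop) :
    ~ (exists f, forall x, Q x (f x)) -> exists x, forall y, ~ Q x y.
  move=> nf; apply: contrapT => nx; apply: nf.
  suff /choice[f Qf] : forall x, exists y, Q x y by exists f.
  by move=> x; apply: contrapT => nQ; apply: nx; exists x => y Qxy; apply: nQ; exists y.
move=> /(noch _ _ (fun y x => R (x, y)))[y0 ny0] /(noch _ _ (fun x y => R (x, y)))[x0 nx0].
case: (maxR (R `|` [set (x0, y0)])).
  split=> [? ?|/(_ (x0, y0)) sub]; first by left.
  by apply: (nx0 y0); apply: sub; right.
move=> x x' y y' [Rxy|[-> ->]] [Rxy'|[-> ->]] //; first exact: PR.
- by split=> E; subst; [case: (nx0 y)|case: (ny0 x)].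
- by split=> E; subst; [case: (nx0 y')|case: (ny0 x')].
Qed.

Section Square.
Variable T : Type.

Definition square_dom (G : set (T * T * T)) : set T :=
  [set x | exists y z, G (x, y, z)].

(* G is the graph of an injection X * X -> X, where X = square_dom G. *)
Definition square_graph (G : set (T * T * T)) : Prop :=
  [/\ forall p p' z z', G (p, z) -> G (p', z') -> p = p' <-> z = z',
      forall x y z, G (x, y, z) -> square_dom G y /\ square_dom G z &
      forall x y, square_dom G x -> square_dom G y -> exists z, G (x, y, z)].

(** Any two triples of the union lie in a single member of the chain, and the conditions are checked
    there. *)
Lemma square_graph_bigcup (F : set (set (T * T * T))) :
  F `<=` square_graph -> total_on F subset ->
  square_graph (\bigcup_(G in F) G).
Proof.
move=> FP totF.
have dom_sub G : F G -> square_dom G `<=` square_dom (\bigcup_(G in F) G).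
  by move=> FG x [y [z Gz]]; exists y, z, G.
split=> [p p' z z' [G1 F1 Gz] [G2 F2 Gz']|x y z [G FG Gz]|].
- have [G [FG {}Gz {}Gz']] : exists G, [/\ F G, G (p, z) & G (p', z')].
    by case: (totF _ _ F1 F2) => sub; [exists G2|exists G1]; split=> //; exact: sub.
  by have [inj _ _] := FP _ FG; apply: inj Gz Gz'.
- have [_ cl _] := FP _ FG; have [Xy Xz] := cl _ _ _ Gz.
  by split; exact: dom_sub Xz || exact: dom_sub Xy.
- move=> x x' [y [z [G1 F1 Gz]]] [y' [z' [G2 F2 Gz']]].
  have [G [FG {}Gz {}Gz']] : exists G, [/\ F G, G (x, y, z) & G (x', y', z')].
    by case: (totF _ _ F1 F2) => sub; [exists G2|exists G1]; split=> //; exact: sub.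
  have [_ _ tot] := FP _ FG.
  have [|| u Gu] := tot x x'; [by exists y, z|by exists y', z'|].
  by exists u, G.
Qed.

(** Hessenberg's theorem. A maximal square graph lives on some [X], which is compared with its
    complement. If the complement embeds in [X], so does [T], and the pairing of [X] serves for [T];
    otherwise [X] embeds in the complement and the graph can be extended, against maximality. *)
Lemma square_injection : infinite_set [set: T] ->
  exists f : T * T -> T, injective f.
Proof.
move=> /infiniteP/card_leTTP[e eI].
have [c cI] : exists c : nat * nat -> nat, injective c.
  by exists pickle; exact: pcan_inj (@pickleK _).
pose G0 : set (T * T * T) :=
  [set q | exists m n, q = (e m, e n, e (c (m, n)))].
have dom0 n : square_dom G0 (e n) by exists (e n), (e (c (n, n))), n, n.
have sG0 : square_graph G0.
  split=> [p p' z z' [m [n [-> ->]]] [m' [n' [-> ->]]]|x y z [m [n [_ -> ->]]]|].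
  - by split=> [[/eI-> /eI->]//|/eI/cI[-> ->]].
  - by split; exact: dom0.
  - move=> _ _ [_ [_ [m [_ [-> _ _]]]]] [_ [_ [n [_ [-> _ _]]]]].
    by exists (e (c (m, n))), m, n.
have [F FP totF|G [[sG G0G] maxG]] := @Zorn_bigcup _
    (fun G => square_graph G /\ (G !=set0 -> G0 `<=` G)).
  split; first by apply: square_graph_bigcup totF => G /FP[].
  move=> [q [G FG Gq]]; apply: (@subset_trans _ G) => [|p]; last by exists G.
  by have [_] := FP _ FG; apply; exists q.
have {G0G} G0G : G0 `<=` G.
  apply: (G0G); apply: contrapT => /nonemptyPn G_0; apply: (maxG G0); last by split=> // _ q.
  rewrite G_0; split=> [?|/(_ (e 0, e 0, e (c (0, 0)))) sub] //.
  by apply: sub; exists 0, 0.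
pose X := square_dom G; have [GI Gcl Gtot] := sG.
have Xe n : X (e n).
  have [y [z Gz]] := dom0 n; exists y, z; exact: G0G.
have /choice[f Gf] (p : T * T) : exists z, X p.1 -> X p.2 -> G (p, z).
  case: p => x y /=; have [[Xx Xy]|nX] := pselect (X x /\ X y).
    by have [z] := Gtot _ _ Xx Xy; exists z.
  by exists x => Xx Xy; case: nX.
have fX x y : X x -> X y -> X (f (x, y)).
  by move=> Xx Xy; have [] := Gcl _ _ _ (Gf (x, y) Xx Xy).
have fI x y x' y' : X x -> X y -> X x' -> X y' -> f (x, y) = f (x', y') ->
    x = x' /\ y = y'.
  move=> Xx Xy Xx' Xy' E.
  by case: ((GI _ _ _ _ (Gf (x, y) Xx Xy) (Gf (x', y') Xx' Xy')).2 E) => -> ->.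
have [[h hI]|[g gI]] := injection_total {x | X x} {x | ~ X x}; last first.
  (* The tags [e 0] and [e 1] keep the images of [X] and of its complement disjoint inside [X]. *)
  pose k t := match pselect (X t) with
    | left _ => f (e 0, t) | right nX => f (e 1, sval (g (exist _ t nX))) end.
  have kX t : X (k t).
    by rewrite /k; case: pselect => [?|nX]; apply: (fX) => //; exact: svalP.
  have kI : injective k.
    move=> s t; rewrite /k.
    case: pselect => [Xs|nXs]; case: pselect => [Xt|nXt] /fI[]//; try exact: svalP.
    - by move=> /eI.
    - by move=> /eI.
    - by move=> _ /sval_inj/gI[].
  exists (fun p => f (k p.1, k p.2)) => -[s t] [s' t'] /= /fI[]//.
  by move=> /kI-> /kI->.
have {h hI} [h hX hI] : exists2 h : T -> T, forall x, X x -> ~ X (h x) &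
    forall x y, X x -> X y -> h x = h y -> x = y.
  exists (fun x => match pselect (X x) with
    | left Xx => sval (h (exist _ x Xx)) | right _ => x end) => [x Xx|x y Xx Xy].
    by case: pselect => // Xx'; exact: (svalP (h _)).
  case: pselect => // Xx'; case: pselect => // Xy'.
  by move=> /sval_inj/hI[].
(* The pairs outside X * X are coded in h X, by means of three injections of
   X * X into X with disjoint ranges. *)
pose hb (b : bool) x := if b then h x else x.
have hbI b b' x x' : X x -> X x' -> hb b x = hb b' x' -> b = b' /\ x = x'.
  case: b b' => -[] //= Xx Xx' E; first by rewrite (hI x x').
    by case: (hX x); rewrite ?E.
  by case: (hX x'); rewrite -?E.
have hbX b x : X x -> X (hb b x) -> b = false.
  by case: b => //= /hX.
have eX n x y : X x -> X y -> X (f (e n, f (x, y))).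
  by move=> Xx Xy; apply: (fX); [exact: Xe|exact: fX].
(* The index [b.*2 + b'] is 1, 2 or 3 on the pairs outside [X * X], and [h] moves the code out of
   [X], away from the values of [G]. *)
pose cd (b b' : bool) x y := h (f (e (b.*2 + b'), f (x, y))).
have cdI b1 b1' b2 b2' x y x' y' : X x -> X y -> X x' -> X y' ->
    cd b1 b2 x y = cd b1' b2' x' y' -> [/\ b1 = b1', b2 = b2', x = x' & y = y'].
  move=> Xx Xy Xx' Xy' /(hI _ _ (eX _ _ _ Xx Xy) (eX _ _ _ Xx' Xy')).
  move=> /(fI _ _ _ _ (Xe _) (fX _ _ Xx Xy) (Xe _) (fX _ _ Xx' Xy'))[/eI].
  move=> + /(fI _ _ _ _ Xx Xy Xx' Xy')[-> ->].
  by case: b1 b1' b2 b2' => -[] [] [].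
pose N (q : T * T * T) := exists b b' x y,
  [/\ X x, X y, b || b' & q = (hb b x, hb b' y, cd b b' x y)].
have GX x y z : G (x, y, z) -> [/\ X x, X y & X z].
  by move=> Gz; have [Xy Xz] := Gcl _ _ _ Gz; split=> //; exists y, z.
have domG' t : square_dom (G `|` N) t <-> exists b x, X x /\ t = hb b x.
  split=> [[y [z [/GX[Xt _ _]|[b [b' [x [y' [Xx Xy _ [-> _ _]]]]]]]]]|].
  - by exists false, t.
  - by exists b, x.
  - move=> [[] [x [Xx ->]]]; last by have [y [z Gz]] := Xx; exists y, z; left.
    by exists (hb true x), (cd true true x x); right; exists true, true, x, x.
have NX x y z : N (x, y, z) -> ~ (X x /\ X y) /\ ~ X z.
  move=> [b [b' [x' [y' [Xx Xy bb [-> -> ->]]]]]]; split.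
    by move=> [/(hbX _ _ Xx) bF /(hbX _ _ Xy) b'F]; move: bb; rewrite bF b'F.
  by apply: hX; exact: eX.
case: (maxG (G `|` N)).
  split=> [?|sub]; first by left.
  have /sub/GX[+ _ _] : (G `|` N) (hb true (e 0), e 0, cd true false (e 0) (e 0)).
    by right; exists true, false, (e 0), (e 0).
  exact: hX.
split; last by move=> _ q /G0G; left.
split.
- move=> [x y] [x' y'] z z' [Gz|Nz] [Gz'|Nz']; first exact: GI.
  + have [Xx Xy Xz] := GX _ _ _ Gz; have [nXX nXz] := NX _ _ _ Nz'.
    by split=> [[? ?]|?]; subst; [case: nXX|case: nXz].
  + have [Xx Xy Xz] := GX _ _ _ Gz'; have [nXX nXz] := NX _ _ _ Nz.
    by split=> [[? ?]|?]; subst; [case: nXX|case: nXz].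
  + move: Nz Nz' => [b1 [b2 [x1 [y1 [Xx1 Xy1 _ [-> -> ->]]]]]].
    move=> [b1' [b2' [x2 [y2 [Xx2 Xy2 _ [-> -> ->]]]]]].
    by split=> [[/hbI[]// -> -> /hbI[]// -> ->]|/cdI[]// -> -> -> ->].
- move=> x y z [/GX[Xx Xy Xz]|[b [b' [x' [y' [Xx Xy _ [_ -> ->]]]]]]].
    by split; apply/domG'; [exists false, y|exists false, z].
  split; apply/domG'; first by exists b', y'.
  exists true, (f (e (b.*2 + b'), f (x', y'))).
  by split=> //; exact: eX.
- move=> _ _ /domG'[b [x [Xx ->]]] /domG'[b' [y [Xy ->]]].
  have [bb|] := boolP (b || b').
    by exists (cd b b' x y); right; exists b, b', x, y.
  case: b b' => -[] // _.
  by have [z Gz] := Gtot _ _ Xx Xy; exists z; left.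
Qed.
End Square.

Lemma card_le_surj T U (h : U -> T) :
  (forall t, exists u, h u = t) -> [set: T] #<= [set: U].
Proof.
move=> /choice[g hg]; apply/card_leTTP; exists g.
by move=> t t' E; rewrite -(hg t) -(hg t') E.
Qed.

Section InfiniteCard.
Variables (A : Type) (Ainf : infinite_set [set: A]).

Lemma card_le_prod T U : [set: T] #<= [set: A] -> [set: U] #<= [set: A] ->
  [set: T * U] #<= [set: A].
Proof.
move=> /card_leTTP[f fI] /card_leTTP[g gI].
have [h hI] := square_injection Ainf.
apply/card_leTTP; exists (fun p => h (f p.1, g p.2)) => -[t u] [t' u'].
by move=> /hI[/fI-> /gI->].
Qed.

Lemma card_le_sum T U : [set: T] #<= [set: A] -> [set: U] #<= [set: A] ->
  [set: T + U] #<= [set: A].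
Proof.
move=> /card_leTTP[f fI] /card_leTTP[g gI].
have /infiniteP natA := Ainf.
apply: card_le_trans (card_le_prod natA (card_lexx [set: A])).
apply/card_leTTP; exists (fun x => match x with
  | inl t => (0, f t) | inr u => (1, g u) end).
by move=> [t|u] [t'|u'] // [] => [/fI|/gI] ->.
Qed.

Lemma card_le_option T : [set: T] #<= [set: A] -> [set: option T] #<= [set: A].
Proof.
move=> TA; have /infiniteP natA := Ainf.
apply: card_le_trans (card_le_sum TA natA).
apply/card_leTTP; exists (fun x => if x is Some t then inl t else inr 0).
by move=> [t|] [t'|] // [->].
Qed.

End InfiniteCard.

(* If p is infinite, then the union of U0 and of the sets F y with y in p has
   cardinality at most p * nat <= p. *)
Lemma exists_fresh A Y Z (p : set Y) (U0 : set Z) (F : Y -> set Z) (code : A -> Z) :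
  infinite_set [set: A] -> injective code -> card_lt p [set: A] -> finite_set U0 ->
  (forall y, finite_set (F y)) ->
  exists a, ~ U0 (code a) /\ forall y, p y -> ~ F y (code a).
Proof.
move=> Ainf codeI [_ pA] U0fin Ffin; apply: contrapT => nfresh.
have cover a : exists y : option {y | p y},
    (if y is Some y' then F (sval y') else U0) (code a).
  apply: contrapT => ncov; apply: nfresh; exists a; split=> [Ua|y py Fa].
    by apply: ncov; exists None.
  by apply: ncov; exists (Some (exist _ y py)).
have [pfin|pinf] := pselect (finite_set p).
  apply: Ainf; apply: (@sub_finite_set _ _ (code @^-1` (U0 `|` \bigcup_(y in p) F y))).
    move=> a _; have [[[y py]|] /= Fa] := cover a; last by left.
    by right; exists y.
  apply: finite_preimage => [? ? _ _|]; first exact: codeI.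
  by rewrite finite_setU; split=> //; exact: bigcup_finite.
have Pinf : infinite_set [set: {y | p y}].
  move=> /(finite_image sval); apply: contra_not pinf => Pfin; apply: sub_finite_set Pfin.
  by move=> y py; exists (exist _ y py).
have enc (y : option {y | p y}) : exists e : Z -> nat,
    {in (if y is Some y' then F (sval y') else U0) &, injective e}.
  by apply/pcard_injP; apply: finite_set_countable; case: y.
have [yc yF] := choice cover; have [e eI] := choice enc.
have natP : [set: nat] #<= [set: {y | p y}] by apply/infiniteP.
have Pp : [set: {y | p y}] #<= p.
  apply/card_le_sigP; exists (sval \o sval) => [|[[]]//].
  by apply: inj_comp; exact: sval_inj.
apply: pA; apply: card_le_trans Pp.
(* An element of [A] is determined by the label of a finite set containing its code and by the
   number that an injection of this set into [nat] gives to the code. *)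
apply: card_le_trans (card_le_prod Pinf (card_le_option Pinf (card_lexx _)) natP).
apply/card_leTTP; exists (fun a => (yc a, e (yc a) (code a))) => a a' [E].
rewrite E => /eI; rewrite !inE => /(_ _ _)/codeI; apply; last exact: yF.
by rewrite -E; exact: yF.
Qed.

(** * Symbols occurring in a sentence *)

(** Nominals and rigid function symbols, the latter of every arity: the structures compared below
    share the interpretation of all the other symbols. *)
Definition cst (D : hsig) : Type :=
  (nom D + {n : nat & {ar : 'I_n -> rsort D & {s : rsort D & rfun ar s}}})%type.

Definition rfun_cst D n (ar : 'I_n -> rsort D) s (f : rfun ar s) : cst D :=
  inr (existT _ n (existT _ ar (existT _ s f))).

Definition occ_label D (l : option (nom D)) : set (cst D) :=
  [set x | omap inl l = Some x].

Fixpoint occ_term D so (t : hterm (D := D) so) : set (cst D) :=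
  match t with
  | TRig _ _ _ f ts => rfun_cst f |` \bigcup_i occ_term (ts i)
  | TFlex l _ _ _ f ts => occ_label l `|` \bigcup_i occ_term (ts i)
  end.

Definition incl_cst D C (srt : C -> esort D) (x : cst D) : cst (extend srt) :=
  match x with
  | inl k => inl (inl k)
  | inr (existT n (existT ar (existT s f))) =>
      @rfun_cst (extend srt) n ar s (inl f)
  end.

(* The equality of two terms of sort @_k s depends on the interpretation of k. *)
Definition occ_sort D (so : hsort D) : set (cst D) :=
  match so with inl _ => set0 | inr (l, _) => occ_label l end.

(** Below a binder, the preimage under [incl_cst] drops the bound variables, which lie outside its
    range. *)
Fixpoint occ D (phi : sen D) : set (cst D) :=
  match phi with
  | SNom k => [set inl k]
  | SEq so t1 t2 => occ_sort so `|` (occ_term t1 `|` occ_term t2)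
  | SRRel _ _ p ts => \bigcup_i occ_term (ts i)
  | SFRel l _ _ p ts => occ_label l `|` \bigcup_i occ_term (ts i)
  | SAt k psi => inl k |` occ psi
  | SNot psi => occ psi
  | SOr _ Gam => \bigcup_i occ (Gam i)
  | SStore psi => incl_cst _ @^-1` occ psi
  | SEx _ X psi => incl_cst X @^-1` occ psi
  | SDia a psi => occ psi
  end.

Lemma incl_cst_inj D C (srt : C -> esort D) : injective (incl_cst srt).
Proof.
pose g (x : cst (extend srt)) : option (cst D) := match x with
  | inl (inl k) => Some (inl k)
  | inr (existT n (existT ar (existT s (inl f)))) => Some (@rfun_cst D n ar s f)
  | _ => None end.
by apply: (@pcan_inj _ _ _ g) => -[|[n [ar [s f]]]].
Qed.

Lemma occ_label_finite D (l : option (nom D)) : finite_set (occ_label l).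
Proof.
case: l => [k|]; last by apply: sub_finite_set (@finite_set0 (cst D)) => x.
by apply: sub_finite_set (finite_set1 (inl k)) => _ [<-].
Qed.

Lemma occ_sort_finite D (so : hsort D) : finite_set (occ_sort so).
Proof.
by case: so => [s|[l s]] /=; [exact: finite_set0|exact: occ_label_finite].
Qed.

Lemma bigcup_ord_finite n T (F : 'I_n -> set T) :
  (forall i, finite_set (F i)) -> finite_set (\bigcup_i F i).
Proof. by move=> Ffin; apply: bigcup_finite. Qed.

Lemma occ_term_finite D so (t : hterm (D := D) so) : finite_set (occ_term t).
Proof.
elim: t => /= *; rewrite finite_setU; split; try exact: bigcup_ord_finite.
  exact: finite_set1.
exact: occ_label_finite.
Qed.

(** Arities and disjunctions are finite, and the injectivity of [incl_cst] keeps the preimages taken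
    below binders finite. *)
Lemma occ_finite D (phi : sen D) : finite_set (occ phi).
Proof.
elim: phi => {D} D /= *; rewrite ?finite_setU; do ?split=> //;
  try by [exact: finite_set1|exact: occ_sort_finite|exact: occ_label_finite|exact: occ_term_finite
    |apply: bigcup_ord_finite => // i; exact: occ_term_finite
    |apply: finite_preimage => // ? ? _ _; exact: incl_cst_inj].
Qed.

(** * The satisfaction condition *)

(* The translations glift g X and those along inclusions, substitutions and
   identities are all of the form [remap], up to conversion.  Hence structures
   over both signatures may share their carriers, and the only equalities
   between carriers to be dealt with are those between interpretations of the
   nominal k in @_k s.  *)
Definition resig (D : hsig) (N : Type)
    (F : forall n, ('I_n -> rsort D) -> rsort D -> Type) : hsig :=
  {| nom := N; modality := modality D; rsort := rsort D; fsort := fsort D;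
     rfun := F; ffun := fun n ar s => ffun ar s; rrel := fun n ar => rrel ar;
     frel := fun n ar => frel ar |}.

Definition remap D N F (onN : nom D -> N)
    (onF : forall n (ar : 'I_n -> rsort D) s,
      rfun ar s -> (F n ar s + hterm (D := resig N F) (inl s))%type) :
    gmap D (resig N F) :=
  @SymMap D (resig N F) (fun n ar s => (F n ar s + hterm (D := resig N F) (inl s))%type)
    onN id id id (fun=> erefl) onF
    (fun n ar s f => @FFlex (resig N F) n ar s f) (fun n ar p => p)
    (fun n ar p => @RFlex (resig N F) n ar p).

Definition rekripke D N F (K : kripke D) (iN : N -> world K)
    (iF : forall n (ar : 'I_n -> rsort D) s,
      F n ar s -> (forall i, rcar K (ar i)) -> rcar K s) : kripke (resig N F) :=
  @Kripke (resig N F) (world K) (world_ne K) iN (@imod D K) (@rcar D K)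
    (@rcar_ne D K) (@fcar D K) (@fcar_ne D K) iF (@iffun D K) (@irrel D K)
    (@ifrel D K).

(** The satisfaction condition at one symbol. A term replacing [f] does not involve [args], so [f]
    is then asked to be constant, with the value of the term at every world; this covers variables
    replaced by rigid terms. *)
Definition compatible D N F (onN : nom D -> N)
    (onF : forall n (ar : 'I_n -> rsort D) s,
      rfun ar s -> (F n ar s + hterm (D := resig N F) (inl s))%type)
    (K : kripke D) (iN : N -> world K)
    (iF : forall n (ar : 'I_n -> rsort D) s,
      F n ar s -> (forall i, rcar K (ar i)) -> rcar K s) (x : cst D) : Prop :=
  match x with
  | inl k => inom K k = iN (onN k)
  | inr (existT n (existT ar (existT s f))) =>
      forall (w : world K) args, irfun f args =
        match onF n ar s f with
        | inl f' => iF n ar s f' args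
        | inr t => eval (K := rekripke iN iF) w t
        end
  end.

Lemma eval_ecast D (K : kripke D) (w : world K) so so' (e : so = so')
    (t : hterm so) :
  eval w (ecast z (hterm z) e t) = ecast z (hcar w z) e (eval w t).
Proof. by case: _ / e. Qed.

(** Equality between elements of the structures at two worlds. At a flexible sort the carrier
    depends on the world, hence the transport along any proof of [u = u']; without such a proof the
    relation holds vacuously. *)
Definition mrel D (K : kripke D) (u u' : world K) (s : fosort D) :
    mcar u s -> mcar u' s -> Prop :=
  match s with
  | inl _ => fun a b => a = b
  | inr f => fun a b => forall E : u = u', ecast v (fcar v f) E a = b
  end.

Lemma mrel_refl D (K : kripke D) (u : world K) (s : fosort D) (a b : mcar u s) :
  mrel a b <-> a = b.
Proof.
case: s a b => [//|f] a b; split=> [/(_ erefl)//|->] E.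
by rewrite (Prop_irrelevance E erefl).
Qed.

Lemma mrel_iffun D (K : kripke D) (u u' : world K) n (ar : 'I_n -> fosort D) s
    (f : ffun ar s) (a : forall i, mcar u (ar i)) (b : forall i, mcar u' (ar i)) :
  u = u' -> (forall i, mrel (a i) (b i)) ->
  mrel (iffun (w := u) f a) (iffun (w := u') f b).
Proof.
move=> E; case: _ / E b => b ab; apply/mrel_refl; congr iffun.
by apply: functional_extensionality_dep => i; apply/mrel_refl.
Qed.

Lemma mrel_ifrel D (K : kripke D) (u u' : world K) n (ar : 'I_n -> fosort D)
    (p : frel ar) (a : forall i, mcar u (ar i)) (b : forall i, mcar u' (ar i)) :
  u = u' -> (forall i, mrel (a i) (b i)) ->
  ifrel (w := u) p a <-> ifrel (w := u') p b.
Proof.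
move=> E; case: _ / E b => b ab; rewrite (_ : a = b) //.
by apply: functional_extensionality_dep => i; apply/mrel_refl.
Qed.

Section Term.
Variables (D : hsig) (N : Type).
Variable F : forall n, ('I_n -> rsort D) -> rsort D -> Type.
Variable onN : nom D -> N.
Variable onF : forall n (ar : 'I_n -> rsort D) s,
  rfun ar s -> (F ar s + hterm (D := resig N F) (inl s))%type.
Variables (K : kripke D) (iN : N -> world K).
Variable iF : forall n (ar : 'I_n -> rsort D) s,
  F ar s -> (forall i, rcar K (ar i)) -> rcar K s.
Let g := remap onN onF.
Let K' := rekripke iN iF.
Let compat := compatible onN onF iN iF.

Definition hrel (w : world K) (so : hsort D) :
    hcar w so -> @hcar _ K' w (hsort_map g so) -> Prop :=
  match so with
  | inl _ => fun a b => a = b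
  | inr (l, f) => fun a b =>
      forall E : at_world w l = @at_world _ K' w (omap onN l),
        ecast v (fcar v f) E a = b
  end.

Lemma compat_label (w : world K) l : occ_label l `<=` compat ->
  at_world w l = @at_world _ K' w (omap onN l).
Proof. by case: l => [k|] //= /(_ (inl k) erefl). Qed.

Lemma hrel_of_hcar (w : world K) l (s : fosort D)
    (a : hcar w (at_sort l s)) (b : @hcar _ K' w (hsort_map g (at_sort l s))) :
  hrel a b ->
  @mrel D K _ _ s (of_hcar a)
    (of_hcar (ecast z (@hcar _ K' w z) (esym (hsort_map_at g l s)) b)).
Proof. by case: s a b. Qed.

(** Induction on [t]. Compatibility at the label identifies the two worlds at which a flexible
    symbol is read, and [mrel_iffun] then compares its values. *)
Lemma eval_term_map (w : world K) so (t : hterm so) : occ_term t `<=` compat ->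
  hrel (eval w t) (@eval _ K' w _ (term_map g t)).
Proof.
elim: t => [n ar s f ts IH|l n ar s f ts IH] /= ct.
  have {}IH i : eval w (ts i) = @eval _ K' w _ (term_map g (ts i)).
    by apply: IH => x xi; apply: ct; right; exists i.
  have : compat (rfun_cst f) by apply: ct; left.
  move=> /(_ w) ->; case: (onF f) => //= f'; congr iF.
  exact: functional_extensionality_dep.
have {}IH i : hrel (eval w (ts i)) (@eval _ K' w _ (term_map g (ts i))).
  by apply: IH => x xi; apply: ct; right; exists i.
have E : at_world w l = @at_world _ K' w (omap onN l).
  by apply: compat_label => x xl; apply: ct; left.
rewrite eval_ecast /=.
set a := iffun _ _; set b := iffun _ _.
have : @mrel D K _ _ s a b.
  apply: mrel_iffun => // i; rewrite eval_ecast.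
  exact: hrel_of_hcar.
by case: (s) a b.
Qed.

End Term.

(* Equality, at two types which are convertible only when s is a constructor. *)
Definition vrel D N F (K : kripke D) (iN : N -> world K)
    (iF : forall n (ar : 'I_n -> rsort D) s,
      F n ar s -> (forall i, rcar K (ar i)) -> rcar K s) (s : esort D) :
    ecar K s -> ecar (rekripke iN iF) (omap id s) -> Prop :=
  match s with None => fun a b => a = b | Some _ => fun a b => a = b end.

Lemma vrel_cast D N F (K : kripke D) (iN : N -> world K)
    (iF : forall n (ar : 'I_n -> rsort D) s,
      F n ar s -> (forall i, rcar K (ar i)) -> rcar K s) (s s' : esort D)
    (e : s = s') (e' : omap id s = omap id s') (a : ecar K s)
    (b : ecar (rekripke iN iF) (omap id s)) :
  vrel a b ->
  vrel (ecast z (ecar K z) e a) (ecast z (ecar (rekripke iN iF) z) e' b).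
Proof. by case: _ / e e' => e'; rewrite (Prop_irrelevance e' erefl). Qed.

Lemma eval_incl D (K : kripke D) C (srt : C -> esort D) (v : valuation K srt)
    (w : world K) s (t : hterm (D := D) (inl s)) :
  @eval _ (expand v) w _ (term_map (gmap_of_mor (incl srt)) t) = eval w t.
Proof.
apply: esym; apply: (@eval_term_map D _ _ inl
  (fun n ar s f => inl (inl f)) K (@inom _ (expand v)) (@irfun _ (expand v)) w
  (inl s) t).
by move=> [k|[n [ar [s' f]]]] //= _.
Qed.

(** Carries compatibility below a binder. The variables agree by [vrel]; a term replacing an old
    symbol is weakened along the inclusion, which preserves its value by [eval_incl]. *)
Lemma compatible_glift D N F (onN : nom D -> N)
    (onF : forall n (ar : 'I_n -> rsort D) s,
      rfun ar s -> (F n ar s + hterm (D := resig N F) (inl s))%type)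
    (K : kripke D) (iN : N -> world K)
    (iF : forall n (ar : 'I_n -> rsort D) s,
      F n ar s -> (forall i, rcar K (ar i)) -> rcar K s)
    C (srt : C -> esort D) (v : valuation K srt)
    (v' : valuation (rekripke iN iF) (lift_srt (remap onN onF) srt))
    (S : set (cst (extend srt))) :
  (forall c, @vrel D N F K iN iF (srt c) (v c) (v' c)) ->
  incl_cst srt @^-1` S `<=` compatible onN onF iN iF ->
  S `<=` compatible (on_nom (glift (remap onN onF) srt))
    (on_rfun (glift (remap onN onF) srt)) (K := expand v)
    (@inom _ (expand v')) (@irfun _ (expand v')).
Proof.
move=> vv' Scomp [[k|[c e]]|[n [ar [s [f|[c [e0 e]]]]]]] Sx.
- exact: (Scomp (inl k)).
- exact: (vrel_cast e (f_equal (omap id) e) (vv' c)).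
- move=> w args; have /= -> := Scomp (rfun_cst f) Sx w args.
  case: (onF n ar s f) => //= t.
  by rewrite (@eval_incl _ (rekripke iN iF) _ _ v').
- move=> w args; exact: (vrel_cast e (f_equal (omap id) e) (vv' c)).
Qed.

Lemma iact_remap D N F (K : kripke D) (iN : N -> world K)
    (iF : forall n (ar : 'I_n -> rsort D) s,
      F n ar s -> (forall i, rcar K (ar i)) -> rcar K s) (a : action (modality D)) :
  @iact _ (rekripke iN iF) (action_map id a) = iact a.
Proof. by elim: a => //= [a -> b ->|a -> b ->|a ->]. Qed.

(* As compatibility is only required at the symbols which occur in phi, this
   also yields the coincidence lemma [sat_reint]. *)
Lemma sat_sen_map D (phi : sen D) N F (onN : nom D -> N)
    (onF : forall n (ar : 'I_n -> rsort D) s,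
      rfun ar s -> (F n ar s + hterm (D := resig N F) (inl s))%type)
    (K : kripke D) (iN : N -> world K)
    (iF : forall n (ar : 'I_n -> rsort D) s,
      F n ar s -> (forall i, rcar K (ar i)) -> rcar K s) (w : world K) :
  occ phi `<=` compatible onN onF iN iF ->
  sat w phi <-> @sat _ (rekripke iN iF) w (sen_map (remap onN onF) phi).
Proof.
elim: phi N F onN onF K iN iF w => {D}
  [D k|D so t1 t2|D n ar p ts|D l n ar p ts|D k psi IH|D psi IH|D n Gam IH
  |D psi IH|D n X psi IH|D a psi IH] N F onN onF K iN iF w /= comp.
- by have /= -> := comp (inl k) erefl.
- have h1 := eval_term_map w (fun x xi => comp x (or_intror (or_introl xi))).
  have h2 := eval_term_map w (fun x xi => comp x (or_intror (or_intror xi))).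
  case: so t1 t2 comp h1 h2 => [r|[l f]] t1 t2 comp /= h1 h2.
    by rewrite h1 h2.
  (* The [occ_sort] part of the support provides this equation; both values are transported along
     it, and transport is injective. *)
  have E : at_world w l = @at_world _ (rekripke iN iF) w (omap onN l).
    by apply: compat_label => x xl; apply: comp; left.
  rewrite -(h1 E) -(h2 E); split=> [->//|].
  move: (eval w t1) (eval w t2); clear; rewrite /=.
  by case: _ / E.
- rewrite (_ : (fun i => eval w (ts i)) =
    (fun i => @eval _ (rekripke iN iF) w _ (term_map (remap onN onF) (ts i)))) //.
  apply: functional_extensionality_dep => i.
  by apply: (eval_term_map w (t := ts i)) => x xi; apply: comp; exists i.
- apply: mrel_ifrel => [|i].
    by apply: compat_label => x xl; apply: comp; left.
  rewrite eval_ecast; apply: hrel_of_hcar; apply: eval_term_map.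
  by move=> x xi; apply: comp; right; exists i.
- have /= <- := comp (inl k) (or_introl erefl).
  by apply: IH => x xi; apply: comp; right.
- have {}IH := IH _ _ _ _ _ _ _ w comp.
  by split=> npsi /IH.
- have {}IH i := IH i _ _ _ _ _ _ _ w (fun x xi => comp x (ex_intro2 _ _ i Logic.I xi)).
  by split=> -[i /IH]; exists i.
- pose v' : valuation (rekripke iN iF) (lift_srt (remap onN onF) (fun _ : 'I_1 => None : esort D)) := fun=> w.
  pose gl := glift (remap onN onF) (fun _ : 'I_1 => None : esort D).
  have H := IH _ _ (on_nom gl) (on_rfun gl) (expand (fun=> w : ecar K None))
    (@inom _ (expand v')) (@irfun _ (expand v')) w.
  refine (H _).
  exact: (@compatible_glift _ _ _ _ _ _ _ _ _ _ _ v').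
- pose gl := glift (remap onN onF) X; split=> -[v vpsi].
    (* The same assignment as [v]: the case analysis on [X c] only makes the two types
       convertible. *)
    pose v' : valuation (rekripke iN iF) (lift_srt (remap onN onF) X) :=
      fun c => match X c as s return ecar K s -> ecar (rekripke iN iF) (omap id s) with
        None => id | Some _ => id end (v c).
    exists v'.
    have := IH _ _ (on_nom gl) (on_rfun gl) (expand v) (@inom _ (expand v')) (@irfun _ (expand v')) w.
    move=> [|+ _]; last exact.
    apply: (@compatible_glift _ _ _ _ _ _ _ _ _ _ _ v') => // c.
    by rewrite /v'; case: (X c) (v c).
  pose v' : valuation K X :=
    fun c => match X c as s return ecar (rekripke iN iF) (omap id s) -> ecar K s with
      None => id | Some _ => id end (v c).
  exists v'.
  have := IH _ _ (on_nom gl) (on_rfun gl) (expand v') (@inom _ (expand v)) (@irfun _ (expand v)) w.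
  move=> [|_ +]; last exact.
  apply: (@compatible_glift _ _ _ _ _ _ _ _ _ _ _ v) => // c.
  rewrite /v'; move: (v c); rewrite /lift_srt /=.
  by case: (X c).
- rewrite iact_remap.
  have {}IH w' := IH _ _ _ _ _ _ _ w' comp.
  by split=> -[w' ww' /IH]; exists w'.
Qed.

(** * Reducts and constants *)

Definition reduct D C (srt : C -> esort D) (K : kripke (extend srt)) : kripke D :=
  @Kripke D (world K) (world_ne K) (fun k => inom K (inl k)) (@imod _ K)
    (@rcar _ K) (@rcar_ne _ K) (@fcar _ K) (@fcar_ne _ K)
    (fun n ar s f => @irfun _ K n ar s (inl f))
    (@iffun _ K) (@irrel _ K) (@ifrel _ K).

Definition reint D (K : kripke D) (iN : nom D -> world K)
    (iF : forall n (ar : 'I_n -> rsort D) s,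
      rfun ar s -> (forall i, rcar K (ar i)) -> rcar K s) : kripke D :=
  @Kripke D (world K) (world_ne K) iN (@imod D K) (@rcar D K) (@rcar_ne D K)
    (@fcar D K) (@fcar_ne D K) iF (@iffun D K) (@irrel D K) (@ifrel D K).

Definition agree D (K : kripke D) (iN : nom D -> world K)
    (iF : forall n (ar : 'I_n -> rsort D) s,
      rfun ar s -> (forall i, rcar K (ar i)) -> rcar K s) (x : cst D) : Prop :=
  match x with
  | inl k => inom K k = iN k
  | inr (existT n (existT ar (existT s f))) =>
      forall args, irfun f args = iF n ar s f args
  end.

Lemma sat_expand_incl D (K : kripke D) C (srt : C -> esort D)
    (v : valuation K srt) (w : world K) phi :
  @sat _ (expand v) w (sen_tr (incl srt) phi) <-> sat w phi.
Proof.
apply: iff_sym; apply: (@sat_sen_map D phi _ _ inl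
  (fun n ar s f => inl (inl f)) K (@inom _ (expand v)) (@irfun _ (expand v)) w).
by move=> [k|[n [ar [s' f]]]].
Qed.

Lemma sat_incl D C (srt : C -> esort D) (K : kripke (extend srt)) (w : world K)
    phi :
  sat w (sen_tr (incl srt) phi) <-> @sat _ (reduct K) w phi.
Proof.
(* Once destructed, [K] is convertible to a [rekripke] of its reduct. *)
case: K w => /= W W0 iN iM R R0 fc f0 iF iff iR ifR w.
set K := @Kripke _ _ _ _ _ _ _ _ _ _ _ _ _.
apply: iff_sym; apply: (@sat_sen_map D phi _ _ inl
  (fun n ar s f => inl (inl f)) (reduct K) iN iF w).
by move=> [k|[n [ar [s' f]]]].
Qed.

(* Both sides are equivalent to the satisfaction by the reinterpretation of the
   image of phi under the identity map. *)
Lemma sat_reint D (K : kripke D) iN iF (w : world K) phi :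
  occ phi `<=` agree iN iF -> sat w phi <-> @sat _ (reint iN iF) w phi.
Proof.
(* Once destructed, the signature is convertible to [resig N F], as [sat_sen_map] requires. *)
case: D K iN iF w phi => N M R Fs F Ff Rr Rf K iN iF w phi Kphi.
set D := @HSig _ _ _ _ _ _ _ _ in K iN iF w phi Kphi *.
apply: (iff_trans (@sat_sen_map D phi N F id (fun n ar s f => inl f) K iN iF w _)).
  move=> [k|[n [ar [s f]]]] /Kphi E; first exact: E.
  by move=> ? ?; exact: E.
apply: iff_sym.
apply: (@sat_sen_map D phi N F id (fun n ar s f => inl f) (reint iN iF) iN iF w).
by move=> [k|[n [ar [s f]]]].
Qed.

Lemma eval_reint D (K : kripke D) iN iF (w : world K) s
    (t : hterm (D := D) (inl s)) :
  occ_term t `<=` agree iN iF -> eval w t = @eval _ (reint iN iF) w _ t.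
Proof.
case: D K iN iF w s t => N M R Fs F Ff Rr Rf K iN iF w s t Kt.
set D := @HSig _ _ _ _ _ _ _ _ in K iN iF w s t Kt *.
apply: (etrans (@eval_term_map D N F id (fun n ar s f => inl f) K iN iF w _ t _)).
  move=> [k|[n [ar [s' f]]]] /Kt E; first exact: E.
  by move=> ? ?; exact: E.
apply: esym.
apply: (@eval_term_map D N F id (fun n ar s f => inl f) (reint iN iF) iN iF w _ t).
by move=> [k|[n [ar [s' f]]]].
Qed.

(** The constant symbols of sort [s]. A rigid one carries its empty arity word, since maps from
    ['I_0] are equal only up to functional extensionality. *)
Definition cname D (s : esort D) : Type :=
  match s with
  | None => nom D
  | Some r => {ar : 'I_0 -> rsort D & rfun ar r}
  end.

Definition ord0_elim (T : 'I_0 -> Type) (i : 'I_0) : T i :=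
  False_rect _ (notF (ltn_ord i)).

Lemma ord0_fun_eq (T : 'I_0 -> Type) (f g : forall i, T i) : f = g.
Proof. by apply: functional_extensionality_dep => -[]. Qed.

Definition cval D (K : kripke D) (s : esort D) : cname s -> ecar K s :=
  match s with
  | None => fun k => inom K k
  | Some r => fun c => irfun (projT2 c) (ord0_elim _)
  end.

Definition cname_cst D (s : esort D) : cname s -> cst D :=
  match s with
  | None => fun k => inl k
  | Some r => fun c => rfun_cst (projT2 c)
  end.

Definition newc D C (srt : C -> esort D) (c : C) (s : esort D) :
    srt c = s -> @cname (extend srt) s :=
  match s with
  | None => fun e => inr (exist _ c e)
  | Some r => fun e =>
      existT _ (ord0_elim (fun=> rsort D)) (inr (exist _ c (conj erefl e)))
  end.

Definition oldc D C (srt : C -> esort D) (s : esort D) :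
    cname s -> @cname (extend srt) s :=
  match s with
  | None => fun k => inl k
  | Some r => fun c => existT _ (projT1 c) (inl (projT2 c))
  end.

Lemma cval_newc D (K : kripke D) C (srt : C -> esort D) (v : valuation K srt) c s
    (e : srt c = s) :
  @cval _ (expand v) s (newc e) = ecast s (ecar K s) e (v c).
Proof. by case: s e. Qed.

Lemma cval_oldc D C (srt : C -> esort D) (K : kripke (extend srt)) s
    (c : @cname D s) : cval K (oldc srt c) = cval (reduct K) c.
Proof. by case: s c. Qed.

Lemma cval_oldc_expand D (K : kripke D) C (srt : C -> esort D)
    (v : valuation K srt) s (c : @cname D s) :
  cval (expand v) (oldc srt c) = cval K c.
Proof. by case: s c. Qed.

(** A classical equality test singles out [c], which alone gets a new value; this is how the fresh
    constant is reinterpreted in [naming_omits]. *)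
Lemma reint_cname D (K : kripke D) s (c : cname s) (x : ecar K s) :
  exists iN iF, cval (@reint D K iN iF) c = x /\
    forall y, y <> cname_cst c -> @agree D K iN iF y.
Proof.
case: s c x => [r [ar f]|k] /= x.
  pose srt_of (y : {n : nat & {ar : 'I_n -> rsort D & {s : rsort D & rfun ar s}}}) :=
    projT1 (projT2 (projT2 y)).
  pose f0 : {n : nat & {ar : 'I_n -> rsort D & {s : rsort D & rfun ar s}}} :=
    existT _ _ (existT _ _ (existT _ _ f)).
  exists (inom K), (fun n ar' s' f' args =>
    match pselect (f0 = existT _ _ (existT _ _ (existT _ _ f'))) with
    | left E => ecast s (rcar K s) (f_equal srt_of E) x
    | right _ => irfun f' args end).
  split=> [|[k|[n [ar' [s' f']]]] //= ne args]; case: pselect => // E.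
    by rewrite (Prop_irrelevance (f_equal _ E) erefl).
  by case: ne; rewrite -E.
exists (fun k' => if pselect (k' = k) then x else inom K k'), (@irfun D K).
split=> [|[k'|[n [ar [s f]]]] //= ne]; case: pselect => // E.
by case: ne; rewrite E.
Qed.

(** * Rigid terms and substitutions *)

(** A rigid term never has a sort of the form [(None, f)], so [True] loses nothing there; at all
    other sorts the carriers at [w] and [w'] coincide. *)
Definition rigid_rel D (K : kripke D) (w w' : world K) (so : hsort D) :
    hcar w so -> hcar w' so -> Prop :=
  match so with
  | inl _ => fun a b => a = b
  | inr (Some _, _) => fun a b => a = b
  | inr (None, _) => fun _ _ => True
  end.

Lemma eval_rigid D (K : kripke D) (w w' : world K) so (t : hterm so) :
  rigid_term t -> rigid_rel (eval w t) (eval w' t).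
Proof.
elim: t => [n ar s f ts IH|[k|] n ar s f ts IH] /= => [rt|[_ rt]|[]//].
  by congr irfun; apply: functional_extensionality_dep => i; exact: IH.
have E i : of_hcar (eval w (ts i)) = of_hcar (eval w' (ts i)).
  have := IH i (rt i); move: (eval w (ts i)) (eval w' (ts i)).
  by case: (ar i).
rewrite (functional_extensionality_dep E).
by move: (iffun _ _); clear; case: s.
Qed.

Definition subst_occ D C (srt : C -> esort D) (s : esort D) :
    @subst_val D s (extend srt) id -> set (cst (extend srt)) :=
  match s with
  | None => fun k => [set inl k]
  | Some _ => fun t => occ_term (sval t)
  end.

Definition subst_eval D C (srt : C -> esort D) (K : kripke (extend srt))
    (w : world K) (s : esort D) : @subst_val D s (extend srt) id -> @ecar _ K s :=
  match s with
  | None => fun k => inom K k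
  | Some _ => fun t => eval w (sval t)
  end.

Lemma subst_occ_finite D C (srt : C -> esort D) (s : esort D)
    (t : @subst_val D s (extend srt) id) : finite_set (subst_occ t).
Proof.
by case: s t => [r t|k]; [exact: occ_term_finite|exact: finite_set1].
Qed.

Lemma subst_eval_reint D C (srt : C -> esort D) (K : kripke (extend srt)) iN iF
    (w : world K) (s : esort D) (t : @subst_val D s (extend srt) id) :
  subst_occ t `<=` @agree _ K iN iF ->
  subst_eval w t = @subst_eval _ _ _ (reint iN iF) w s t.
Proof.
case: s t => [r t|k] Kt /=; first exact: eval_reint.
exact: (Kt (inl k)).
Qed.

(** The worlds on the two sides may differ because a substitution takes its values among nominals
    and rigid terms. *)
Lemma subst_eval_ecast D C (srt : C -> esort D) (K : kripke (extend srt))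
    (w w' : world K) (s s' : esort D) (e : s = s')
    (t : @subst_val D s (extend srt) id) :
  ecast z (@ecar _ K z) e (subst_eval w t) =
  @subst_eval _ _ _ K w' s' (ecast z (@subst_val D z (extend srt) id) e t).
Proof.
case: _ / e; case: s t => [r [t rt]|k] //=.
exact: (eval_rigid w w' rt).
Qed.

(** The substitution lemma, as an instance of [sat_sen_map]; [w0] only serves to evaluate rigid
    terms and may be any world. *)
Lemma sat_subst D C1 (srt1 : C1 -> esort D) C2 (srt2 : C2 -> esort D)
    (theta : subst srt1 srt2) (K : kripke (extend srt2)) (w w0 : world K)
    (phi : sen (extend srt1)) :
  sat w (sen_subst theta phi) <->
  @sat _ (@expand D (reduct K) C1 srt1 (fun c => subst_eval w0 (theta c))) w phi.
Proof.
case: K w w0 => /= W W0 iN iM R R0 fc f0 iF iff iR ifR w w0.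
set K := @Kripke _ _ _ _ _ _ _ _ _ _ _ _ _.
set v := (fun c => _).
apply: iff_sym; apply: (@sat_sen_map (extend srt1) phi _ _
  (on_nom (gmap_of_subst theta)) (on_rfun (gmap_of_subst theta))
  (@expand D (reduct K) C1 srt1 v) iN iF w).
move=> [[k|[c e]]|[n [ar [s [f|[c [e0 e]]]]]]] _ //=.
- exact: (@subst_eval_ecast _ _ _ K w0 w0 _ _ e (theta c)).
- move=> w1 _; exact: (@subst_eval_ecast _ _ _ K w0 w1 _ _ e (theta c)).
Qed.

(** * The extension by constants naming all the elements *)

Section Power.
Variables (D : hsig) (C : Type) (srt : C -> esort D).

Definition new_symbol (c : C) (s : esort D) : srt c = s -> symbol (extend srt) :=
  match s with
  | None => fun e => inl (inl (inl (inl (inl (inl (inl (inr (exist _ c e))))))))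
  | Some r => fun e => inl (inl (inl (inr
      (existT _ 0%N (existT _ (ord0_elim (fun=> rsort D))
        (existT _ r (inr (exist _ c (conj erefl e)))))))))
  end.

Definition symbol_of (x : symbol D + C) : symbol (extend srt) :=
  match x with
  | inl (inl (inl (inl (inl (inl (inl (inl k))))))) =>
      inl (inl (inl (inl (inl (inl (inl (inl k)))))))
  | inl (inl (inl (inl (inl (inl (inl (inr m))))))) =>
      inl (inl (inl (inl (inl (inl (inr m))))))
  | inl (inl (inl (inl (inl (inl (inr s)))))) =>
      inl (inl (inl (inl (inl (inr s)))))
  | inl (inl (inl (inl (inl (inr s))))) => inl (inl (inl (inl (inr s))))
  | inl (inl (inl (inl (inr (existT n (existT ar (existT s f))))))) =>
      inl (inl (inl (inr (existT _ n (existT _ ar (existT _ s (inl f)))))))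
  | inl (inl (inl (inr f))) => inl (inl (inr f))
  | inl (inl (inr p)) => inl (inr p)
  | inl (inr p) => inr p
  | inr c => new_symbol (erefl (srt c))
  end.

Lemma symbol_of_surj (y : symbol (extend srt)) : exists x, symbol_of x = y.
Proof.
have new c s (e : srt c = s) : symbol_of (inr c) = new_symbol e.
  by case: _ / e.
move: y => [[[[[[[[k|[c e]]|m]|s]|s]|[n [ar [s [f|[c [e0 e]]]]]]]|f]|p]|p].
- by exists (inl (inl (inl (inl (inl (inl (inl (inl k)))))))).
- by exists (inr c); rewrite (new c _ e).
- by exists (inl (inl (inl (inl (inl (inl (inl (inr m)))))))).
- by exists (inl (inl (inl (inl (inl (inl (inr s))))))).
- by exists (inl (inl (inl (inl (inl (inr s)))))).
- by exists (inl (inl (inl (inl (inr (existT _ n (existT _ ar (existT _ s f)))))))).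
- exists (inr c); rewrite (new c _ e); subst n.
  by rewrite (ord0_fun_eq ar (ord0_elim _)).
- by exists (inl (inl (inl (inr f)))).
- by exists (inl (inl (inr p))).
- by exists (inl (inr p)).
Qed.

Lemma power_le_extend A : [set: C] #<= [set: A] -> power_le D A ->
  power_le (extend srt) A.
Proof.
move=> CA [natA symA]; split=> //.
apply: card_le_trans (card_le_surj symbol_of_surj) _.
by apply: card_le_sum => //; apply/infiniteP.
Qed.

End Power.

(** Sorts are counted among the symbols; hence [A] can index the types, one for each sort. *)
Lemma card_le_esort D A : power_le D A -> [set: esort D] #<= [set: A].
Proof.
move=> [/infiniteP Ainf symA]; apply: card_le_option => //.
apply: card_le_trans symA; apply/card_leTTP.
by exists (fun s => inl (inl (inl (inl (inl (inr s)))))) => s s' [].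
Qed.

Lemma oldc_newc_cst_inj D C (srt : C -> esort D) C' (srt' : C' -> esort (extend srt))
    c1 c2 s (e1 : srt c1 = s) (e2 : srt c2 = s) :
  cname_cst (oldc srt' (newc e1)) = cname_cst (oldc srt' (newc e2)) -> c1 = c2.
Proof.
pose g (x : cst (extend srt')) : option C := match x with
  | inl (inl (inr (exist c _))) => Some c
  | inr (existT _ (existT _ (existT _ (inl (inr (exist c _)))))) => Some c
  | _ => None end.
have gE c (e : srt c = s) : g (cname_cst (oldc srt' (newc e))) = Some c.
  by case: s e {e1 e2}.
by move=> /(f_equal g); rewrite !gE => -[].
Qed.

(** Rigid constants are compared by an equation; for nominals, the sentence stating that the current
    world is [k2] is retrieved at [k1]. *)
Lemma expressible_neq (L : fragment) D (s : esort D) (c1 c2 : cname s) :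
  closed_equality L -> closed_retrieve L -> closed_negation L -> fsig L D ->
  expressible L (fun (K : kripke D) _ => cval K c1 <> cval K c2).
Proof.
move=> Leq Lat Lnot LD.
suff [phi Lphi phiE] : expressible L (fun (K : kripke D) _ => cval K c1 = cval K c2).
  have [psi Lpsi psiE] := Lnot _ LD _ Lphi.
  by exists psi => // K w; rewrite psiE /= phiE.
case: s c1 c2 => [r c1 c2|k1 k2].
  have [phi Lphi phiE] := (Leq _ LD).2 (inl r)
    (TRig (projT2 c1) (ord0_elim _)) (TRig (projT2 c2) (ord0_elim _)).
  exists phi => // K w; rewrite phiE.
  have ev (c : @cname D (Some r)) :
      eval w (TRig (projT2 c) (ord0_elim _)) = cval K c.
    by congr irfun; exact: ord0_fun_eq.
  by rewrite !ev.
have [phi Lphi phiE] := (Leq _ LD).1 k2.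
have [psi Lpsi psiE] := Lat _ LD k1 _ Lphi.
by exists psi => // K w; rewrite psiE /= phiE.
Qed.

Definition naming D A : esort D * A -> esort D := fst.

(* The sentences x <> c need not belong to L; the type consists of all the
   sentences of L which are equivalent to one of them. *)
Definition unnamed (L : fragment) D A (s : esort D) :
    set (sen (@extend (extend (@naming D A)) unit (fun=> s))) :=
  [set phi | fsen L phi /\ exists a, forall K w, @sat _ K w phi <->
    cval K (@newc (extend (@naming D A)) unit (fun=> s) tt s erefl) <>
    cval K (@oldc (extend (@naming D A)) unit (fun=> s) s
             (@newc D _ (@naming D A) (s, a) s erefl))].

Lemma fsig_extend (L : fragment) D C (srt : C -> esort D) :
  fsig L D -> fsig L (extend srt).
Proof. by move=> /(fmor_incl srt)/fmor_sig[]. Qed.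

Section Naming.
Variables (L : fragment) (A : Type) (D : hsig) (T : set (sen D)).
Hypotheses (Leq : closed_equality L) (Lat : closed_retrieve L).
Hypotheses (Lnot : closed_negation L) (Ainf : infinite_set [set: A]).
Hypothesis LD : fsig L D.
Let DC := extend (@naming D A).
Let TC : set (sen DC) := sen_tr (incl (@naming D A)) @` T.

Lemma naming_omits (s : esort DC) : card_omits L A TC (@unnamed L D A s).
Proof.
move=> [C' [srt' [theta [p [_ [_ pA] [K KTp] Tp_theta]]]]].
have [w0] := world_ne K.
pose x := subst_eval w0 (theta tt).
pose code a := cname_cst (@oldc DC _ srt' s (@newc D _ (@naming D A) (s, a) s erefl)).
have codeI : injective code.
  move=> a a' E.
  by have [] := @oldc_newc_cst_inj D _ (@naming D A) _ srt' (s, a) (s, a') s erefl erefl E.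
(* The constant of index [a] occurs neither in the value of [theta] nor in a sentence of [p]. *)
have [a [a_theta a_p]] := exists_fresh Ainf codeI pA
  (subst_occ_finite (theta tt)) (@occ_finite _).
have [iN [iF [a_x agr]]] := reint_cname
  (@oldc DC _ srt' s (@newc D _ (@naming D A) (s, a) s erefl)) x.
pose K' := reint iN iF.
(* Recognizes the rigid function symbols coming from [D]; the reinterpreted constant is none of
   them, so the sentences of [T] remain true. *)
pose is_old (y : cst (extend srt')) := match y with
  | inr (existT _ (existT _ (existT _ (inl (inl _))))) => true
  | _ => false end.
have K'Tp : models K' (sen_tr (incl srt') @` TC `|` p).
  move=> psi [[_ [phi Tphi <-] <-] w|ppsi w].
    apply: (sat_incl (K := K') w _).2.
    apply: (sat_incl (K := reduct K') w _).2.
    have Kphi : gsat K (sen_tr (incl srt') (sen_tr (incl (@naming D A)) phi)).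
      apply: KTp; left.
      by exists (sen_tr (incl (@naming D A)) phi) => //; exists phi.
    have : @sat _ (reduct (reduct K)) w phi.
      apply: (sat_incl (K := reduct K) w phi).1.
      exact: (sat_incl (K := K) w _).1 (Kphi w).
    refine (@sat_reint D (reduct (reduct K)) (fun k => iN (inl (inl k)))
      (fun n ar s f => iF n ar s (inl (inl f))) w phi _).1.
    move=> [k|[n [ar [r f]]]] _.
      apply: (agr (inl (inl (inl k)))).
      by case: (s) => [r|] //; case.
    apply: (agr (inr (existT _ n (existT _ ar (existT _ r (inl (inl f))))))).
    by case: (s) => [r'|] // /(f_equal is_old) /=.
  have : sat (K := K) w psi by apply: (KTp psi); right.
  refine (@sat_reint _ K iN iF w psi _).1 => y ypsi; apply: agr => yE.
  by apply: (a_p psi ppsi); rewrite /code -yE.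
have [phi Lphi phiE] := @expressible_neq L (@extend DC unit (fun=> s)) s
  (@newc DC unit (fun=> s) tt s erefl)
  (@oldc DC unit (fun=> s) s (@newc D _ (@naming D A) (s, a) s erefl))
  Leq Lat Lnot (@fsig_extend L _ _ _ (@fsig_extend L _ _ _ LD)).
(* The sentence [phi] of the type says that the variable differs from the constant of index [a], but
   in [K'] this constant has the value of [theta tt], which the reinterpretation leaves
   unchanged. *)
have : gsat K' (sen_subst theta phi).
  by apply: (Tp_theta _ K'Tp); exists phi => //; split=> //; exists a.
move=> /(_ w0)/(sat_subst (K := K') theta w0 w0 phi)/phiE; apply.
rewrite cval_newc cval_oldc_expand -cval_oldc a_x /=.
rewrite -subst_eval_reint // => y yt; apply: agr => yE.
by apply: a_theta; rewrite /code -yE.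
Qed.

(** An element named by no constant would realize the type; hence the constants of sort [s] give a
    map from [A] onto the carrier. *)
Lemma omits_unnamed_card (s : esort DC) (K : kripke DC) :
  omits K (@unnamed L D A s) -> [set: ecar K s] #<= [set: A].
Proof.
move=> Kom; apply: (card_le_surj
  (h := fun a => cval K (@newc D _ (@naming D A) (s, a) s erefl))) => x.
apply: contrapT => x_unnamed; apply: Kom.
exists (fun=> x) => phi [_ [a phiE]] w; apply/phiE.
rewrite cval_newc cval_oldc_expand /= => x_a.
by apply: x_unnamed; exists a.
Qed.

Lemma naming_satisfiable : satisfiable T -> satisfiable TC.
Proof.
move=> [K KT].
have ne s : exists x : ecar K s, True.
  by case: s => [r|]; [have [x] := rcar_ne K r|have [x] := world_ne K]; exists x.
pose v : valuation K (@naming D A) := fun c => sval (cid (ne (naming c))).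
exists (expand v) => _ [phi Tphi <-] w.
exact: (@sat_expand_incl D K _ _ v w phi).2 (KT phi Tphi w).
Qed.

End Naming.

Theorem theorem52 (L : fragment) (A : Type) :
  closed_equality L ->
  closed_retrieve L ->
  closed_negation L ->
  closed_disjunction L ->
  closed_possibility L ->
  closed_quantifiers L ->
  infinite_set [set: A] ->
  OTP L A ->
  forall D : hsig, fsig L D -> power_le D A ->
  forall T : set (sen D), T `<=` @fsen L D -> satisfiable T ->
  exists K : kripke D,
    [/\ models K T,
        [set: world K] #<= [set: A] &
        forall (w : world K) (s : rsort D), [set: mcar w (inl s)] #<= [set: A]].
Proof.
move=> Leq Lat Lnot _ _ _ Ainf Lotp D LD DA T LT Tsat.
have sortA := card_le_esort DA.
(* The types have to be indexed by [A]; the indices outside the range of [e] repeat the sort of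
   worlds. *)
have [srt srt_surj] : exists srt : A -> esort D, forall s, exists a, srt a = s.
  have /card_leTTP[e eI] := sortA.
  exists (fun a => if pselect (exists s, e s = a) is left E then sval (cid E) else None).
  move=> s; exists (e s); case: pselect => [E|[]]; last by exists s.
  exact: eI (svalP (cid E)).
pose DC := extend (@naming D A).
have [||||||K KT Kom] := Lotp DC (fsig_extend _ LD) _
  (sen_tr (incl (@naming D A)) @` T) _ _ (fun=> unit) (fun i => fun=> srt i)
  (fun i => @unnamed L D A (srt i)).
- by apply: power_le_extend => //; exact: card_le_prod.
- by move=> _ [phi Tphi <-]; apply: fsen_tr (LT _ Tphi); exact: fmor_incl.
- exact: naming_satisfiable.
- by move=> i s; exact: finite_finset.
- by move=> i phi [].
- by move=> i; exact: naming_omits.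
have car s : [set: ecar K s] #<= [set: A].
  by have [i <-] := srt_surj s; exact: omits_unnamed_card (Kom i).
(* Forgetting the new constants changes neither the worlds nor the carriers. *)
exists (reduct K); split=> [phi Tphi w||w s].
- by apply: (sat_incl (K := K) w phi).1; apply: KT; exists phi.
- exact: car None.
- exact: car (Some s).
Qed.
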